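(* Let the loss function $L$ be Lipschitz in its second argument (in trace norm, uniformly in the first argument). Let $\bullet\in\{\mathrm w,\mathrm a\}$ denote worst-case or average risk. For each $m\ge1$, let $T^{(m)\ast}_{AB_1\cdots B_m}$ be the Choi matrix of a symmetric (exchange-invariant or bosonic) $1\to m$ protocol that is optimal, i.e. minimizes the one-site risk $\mathcal L_{\bullet,\mathrm{one}}$ among symmetric $1\to m$ protocols. Assume that the one-site marginals $T^{(m)\ast}_{AB_1}=\operatorname{Tr}_{B_2\cdots B_m}T^{(m)\ast}_{AB_1\cdots B_m}$ converge in trace norm, as $m\to\infty$, to some $T^\ast_{AB_1}$. Then $T^\ast_{AB_1}$ is separable across $A:B_1$. Moreover, the corresponding channel $\mathcal T^\ast_{AB_1}$ attains the optimal entanglement-breaking risk: $$\mathcal L_\bullet\bigl(\mathcal T^\ast_{AB_1}\bigr)=\widetilde{\mathcal L}^\ast_\bullet .$$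
   Context: All Hilbert spaces are finite dimensional: $\mathbb H_A=\mathbb C^{d_A}$ and $\mathbb H_{B_i}\cong\mathbb C^{d_B}$, with $d_A,d_B$ fixed. A $1\to m$ protocol is a channel $\mathcal T:\mathcal B(\mathbb H_A)\to\mathcal B(\mathbb H_{B_1}\otimes\cdots\otimes\mathbb H_{B_m})$; its Choi matrix is $T=\sum_{i,j}|i\rangle\langle j|_A\otimes\mathcal T(|i\rangle\langle j|)$. It is exchange-invariant if its Choi matrix is invariant under conjugation by every permutation unitary of $B_1,\dots,B_m$; it is bosonic if its output is supported on the totally symmetric subspace of $\mathbb H_B^{\otimes m}$. ''Symmetric'' means one fixed choice of these two classes, for all $m$. A channel is entanglement-breaking iff its Choi matrix is separable across the input-output cut. Inference task: $\mathcal X$ is a set of density operators on $\mathbb H_A$ (with a prior probability measure $\pi$ for average risks), $\gamma(\Sigma)$ is a target density operator on $\mathbb C^{d_B}$ for each $\Sigma\in\mathcal X$, and $L$ is a real-valued loss. The Lipschitz condition reads: there is $L_0$ with $|L(\gamma(\Sigma),\tau)-L(\gamma(\Sigma),\tau')|\le L_0\|\tau-\tau'\|_1$ for all $\Sigma\in\mathcal X$ and density operators $\tau,\tau'$. For a single-output channel $\mathcal S$: $\mathcal L_{\mathrm w}(\mathcal S)=\sup_{\Sigma\in\mathcal X}L(\gamma(\Sigma),\mathcal S(\Sigma))$ and $\mathcal L_{\mathrm a}(\mathcal S)=\int_{\mathcal X}L(\gamma(\Sigma),\mathcal S(\Sigma))\,d\pi(\Sigma)$. For a symmetric $m$-output protocol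 all one-site marginals coincide, and $\mathcal L_{\bullet,\mathrm{one}}(\mathcal T)$ is $\mathcal L_\bullet$ of the marginal channel $\Sigma\mapsto\operatorname{Tr}_{B_2\cdots B_m}\mathcal T(\Sigma)$. $\widetilde{\mathcal L}^\ast_\bullet$ is the infimum of $\mathcal L_\bullet$ over all entanglement-breaking channels $\mathcal B(\mathbb H_A)\to\mathcal B(\mathbb H_{B_1})$. *)

(* Defs.v *)
From HB Require Import structures.
From mathcomp Require Import all_boot all_order all_fingroup all_algebra.
From mathcomp Require Import complex mxtens.
From mathcomp Require Import all_classical all_reals all_analysis.

Set Implicit Arguments.
Unset Strict Implicit.
Unset Printing Implicit Defensive.

Import Order.TTheory GRing.Theory Num.Theory.
Import numFieldNormedType.Exports.

Local Open Scope classical_set_scope.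
Local Open Scope ring_scope.
Local Open Scope sesquilinear_scope.

HB.instance Definition _ (R : realType) := isPointed.Build R[i] 0.

Section Operators.
Context {R : realType}.
Local Notation C := R[i].

(* The order of R[i] makes [0 <= z] mean "z is real and nonnegative", so the
   condition forces M to be Hermitian. *)
Definition psd n (M : 'M[C]_n) : Prop :=
  forall v : 'cV[C]_n, 0 <= (v^t* *m M *m v) 0 0.

Definition density n (M : 'M[C]_n) : Prop := psd M /\ \tr M = 1.

(* tr |A|: the sum of the square roots of the eigenvalues of the normal matrix
   A^* A; the sum is a nonnegative real, so taking Re loses nothing. *)
Definition trnorm n (A : 'M[C]_n) : R :=
  complex.Re (\sum_i sqrtC (spectral_diag (A^t* *m A) 0 i)).

(* The (i, j) block of an operator on C^k (x) C^p, with the index convention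
   of the Kronecker product *t. *)
Definition tblock k p (M : 'M[C]_(k * p)) (i j : 'I_k) : 'M[C]_p :=
  \matrix_(a, b) M (mxtens_index (i, a)) (mxtens_index (j, b)).

(* id_k (x) S *)
Definition ampl k p q (S : 'M[C]_p -> 'M[C]_q) (M : 'M[C]_(k * p)) :
    'M[C]_(k * q) :=
  \sum_i \sum_j delta_mx i j *t S (tblock M i j).

Definition completely_positive p q (S : 'M[C]_p -> 'M[C]_q) : Prop :=
  forall k (M : 'M[C]_(k * p)), psd M -> psd (ampl S M).

Definition channel p q (S : 'M[C]_p -> 'M[C]_q) : Prop :=
  [/\ linear S, completely_positive S & forall M, \tr (S M) = \tr M].

Definition choi p q (S : 'M[C]_p -> 'M[C]_q) : 'M[C]_(p * q) :=
  \sum_i \sum_j delta_mx i j *t S (delta_mx i j).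

(* No normalization: this is the cone generated by the product states, since a
   Choi matrix has trace p. *)
Definition separable p q (M : 'M[C]_(p * q)) : Prop :=
  exists (n : nat) (P : 'I_n -> 'M[C]_p) (Q : 'I_n -> 'M[C]_q),
    [/\ forall k, psd (P k), forall k, psd (Q k) & M = \sum_k P k *t Q k].

Definition entanglement_breaking p q (S : 'M[C]_p -> 'M[C]_q) : Prop :=
  separable (choi S).

End Operators.

(* The dimension of (C^d)^{(x) m}.  Its computational basis is
   {ffun 'I_m -> 'I_d}, f standing for |f 0> (x) ... (x) |f (m-1)>, numbered by
   enum_rank / enum_val. *)
Definition tpow (d m : nat) : nat := #|{: {ffun 'I_m -> 'I_d}}|.

Definition ffcons d m (b : 'I_d) (g : {ffun 'I_m -> 'I_d}) :
    {ffun 'I_m.+1 -> 'I_d} :=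
  [ffun i => if unlift ord0 i is Some j then g j else b].

Section Protocols.
Context {R : realType}.
Local Notation C := R[i].

(* Permutation of the tensor factors: |f> |-> |f o s^-1>. *)
Definition perm_op d m (s : 'S_m) : 'M[C]_(tpow d m) :=
  \matrix_(x, y)
    let f : {ffun 'I_m -> 'I_d} := enum_val y in
    (enum_val x == [ffun i => f ((s^-1)%g i)])%:R.

(* Tr_{B_2 ... B_{m+1}} *)
Definition ptrace_rest d m (M : 'M[C]_(tpow d m.+1)) : 'M[C]_d :=
  \matrix_(b, b') \sum_(g : {ffun 'I_m -> 'I_d})
    M (enum_rank (ffcons b g)) (enum_rank (ffcons b' g)).

Definition exchange_invariant p d m (T : 'M[C]_p -> 'M[C]_(tpow d m)) : Prop :=
  forall s : 'S_m,
    let U := 1%:M *t perm_op d s in U *m choi T *m U^t* = choi T.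

Definition totally_symmetric d m (v : 'cV[C]_(tpow d m)) : Prop :=
  forall s : 'S_m, perm_op d s *m v = v.

(* The support of the Hermitian matrix T rho is its range. *)
Definition bosonic p d m (T : 'M[C]_p -> 'M[C]_(tpow d m)) : Prop :=
  forall rho, density rho -> forall v, totally_symmetric (T rho *m v).

Variant symmetry_class := ExchangeInvariant | Bosonic.

Definition symmetric_protocol (c : symmetry_class) p d m
    (T : 'M[C]_p -> 'M[C]_(tpow d m)) : Prop :=
  channel T /\
  match c with
  | ExchangeInvariant => exchange_invariant T
  | Bosonic => bosonic T
  end.

End Protocols.

Section Risks.
Context {R : realType} (p d : nat).
Local Notation C := R[i].

(* A probability measure on X for an arbitrary sigma-algebra on X.  The latter
   is presented as a sigma-algebra on all matrices, generated by some family
   prior_events, having X as an event. *)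
Record prior (X : set 'M[C]_p) := Prior {
  prior_events : set (set 'M[C]_p);
  prior_law : probability (g_sigma_algebraType prior_events) R;
  prior_measurable :
    measurable (X : set (g_sigma_algebraType prior_events));
  prior_full : prior_law X = 1%E }.

Variant risk_kind (X : set 'M[C]_p) := WorstCase | Average of prior X.

Definition lipschitz_loss (X : set 'M[C]_p) (gamma : 'M[C]_p -> 'M[C]_d)
    (L : 'M[C]_d -> 'M[C]_d -> R) : Prop :=
  exists L0 : R, forall Sigma tau tau', X Sigma -> density tau ->
    density tau' ->
    `|L (gamma Sigma) tau - L (gamma Sigma) tau'| <= L0 * trnorm (tau - tau').

(* Risks are extended reals: a worst-case risk may be +oo. *)
Definition risk (X : set 'M[C]_p) (k : risk_kind X)
    (gamma : 'M[C]_p -> 'M[C]_d) (L : 'M[C]_d -> 'M[C]_d -> R)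
    (S : 'M[C]_p -> 'M[C]_d) : \bar R :=
  match k with
  | WorstCase => ereal_sup [set (L (gamma Sigma) (S Sigma))%:E | Sigma in X]
  | Average pi =>
      (\int[prior_law pi]_(Sigma in X) (L (gamma Sigma) (S Sigma))%:E)%E
  end.

(* The integrals defining the average risks are meaningful; void for the
   worst-case risk. *)
Definition risk_measurable (X : set 'M[C]_p) (k : risk_kind X)
    (gamma : 'M[C]_p -> 'M[C]_d) (L : 'M[C]_d -> 'M[C]_d -> R) : Prop :=
  match k with
  | WorstCase => True
  | Average pi => forall S : 'M[C]_p -> 'M[C]_d, channel S ->
      measurable_fun (X : set (g_sigma_algebraType (prior_events pi)))
        (fun Sigma => L (gamma Sigma) (S Sigma))
  end.

Definition one_site_risk (X : set 'M[C]_p) (k : risk_kind X)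
    (gamma : 'M[C]_p -> 'M[C]_d) (L : 'M[C]_d -> 'M[C]_d -> R) m
    (T : 'M[C]_p -> 'M[C]_(tpow d m.+1)) : \bar R :=
  risk k gamma L (fun Sigma => ptrace_rest (T Sigma)).

Definition eb_optimal_risk (X : set 'M[C]_p) (k : risk_kind X)
    (gamma : 'M[C]_p -> 'M[C]_d) (L : 'M[C]_d -> 'M[C]_d -> R) : \bar R :=
  ereal_inf [set risk k gamma L S | S in
    [set S | channel S /\ entanglement_breaking S]].

Definition optimal_symmetric (c : symmetry_class) (X : set 'M[C]_p)
    (k : risk_kind X) (gamma : 'M[C]_p -> 'M[C]_d)
    (L : 'M[C]_d -> 'M[C]_d -> R) m
    (T : 'M[C]_p -> 'M[C]_(tpow d m.+1)) : Prop :=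
  symmetric_protocol c T /\
  forall T' : 'M[C]_p -> 'M[C]_(tpow d m.+1), symmetric_protocol c T' ->
    (one_site_risk k gamma L T <= one_site_risk k gamma L T')%E.

End Risks.

(* Main.v *)
(** One-site marginals of exchangeable operators on C^p (x) (C^d)^(x)m approach
    the separable cone as m grows.  Measure the sites one after the other with an
    informationally complete measurement: the mean of tr(A^2) / tr A over the
    conditional operators A on C^p is nondecreasing and bounded, hence some
    measurement changes A very little; A is then nearly independent of the site
    measured, and by exchangeability the same holds for the first site.  The
    separable cone is closed (Caratheodory and compactness), so the limit is
    separable.  Conversely a measure-and-prepare channel can prepare m identical
    pure copies, so its risk bounds from above the optimal symmetric risk for every
    m, and the Lipschitz condition passes this bound to the limit. *)

Require Import Defs.
From HB Require Import structures.
From mathcomp Require Import all_boot all_order all_fingroup all_algebra.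
From mathcomp Require Import complex mxtens.
From mathcomp Require Import all_classical all_reals all_analysis.
From mathcomp Require Import measurable_realfun ring lra.

Set Implicit Arguments.
Unset Strict Implicit.
Unset Printing Implicit Defensive.

Import Order.TTheory GRing.Theory Num.Theory.
Import numFieldNormedType.Exports.
Local Open Scope classical_set_scope.
Local Open Scope ring_scope.
Local Open Scope sesquilinear_scope.

(** Conditional operators are never normalized: the trace of such an operator is the weight of its
    outcome, means over outcomes become plain sums, and outcomes of weight zero are absorbed by the
    convention [0^-1 = 0]. The potential [tr(A^2) / tr A] is the purity times the weight. Its
    increment under a measurement is exactly a weighted variance, so Cauchy-Schwarz turns a small
    increment into near independence of the outcome. Which measurement has a small increment depends
    on the earlier outcomes. Hence no common step is selected: an induction on the sites decides for
    each history of outcomes and bounds [m] times the squared distance to the separable cone by the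
    potential still available, which gives an error of order [1 / sqrt m]. Effects and dual frame
    are explicit, so the constants depend on the two dimensions only. Conditioning and partial
    traces constantly reindex words of basis labels; positivity is therefore handled as a Gram
    factorization over arbitrary finite types. Risks may be infinite, so they are compared up to an
    additive [e]. *)

Local Notation normc := ComplexField.Normc.normc.

(** * Gram kernels *)

Section Modulus.
Context {R : realType}.
Local Notation C := R[i].
Implicit Types z w : C.

Lemma normc_ge0 z : 0 <= normc z.
Proof. by rewrite -lecR; exact: (@normr_ge0 _ C). Qed.

Lemma normcN z : normc (- z) = normc z.
Proof. exact: complex.normcN. Qed.

Lemma normc_le_sum (I : finType) (F : I -> C) :
  normc (\sum_i F i) <= \sum_i normc (F i).
Proof. by rewrite -lecR rmorph_sum; exact: (@ler_norm_sum _ C). Qed.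

Lemma normc_sqr z : normc z ^+ 2 = complex.Re z ^+ 2 + complex.Im z ^+ 2.
Proof. by case: z => a b /=; rewrite sqr_sqrtr // addr_ge0 // sqr_ge0. Qed.

Lemma normc_conj z : normc z^* = normc z.
Proof. by case: z => a b /=; rewrite sqrrN. Qed.

Lemma mul_conjC_normc z : z * z^* = (normc z ^+ 2)%:C%C.
Proof. by rewrite -normCK rmorphXn. Qed.

Lemma normc_nneg (a : R) : 0 <= a -> normc a%:C%C = a.
Proof. by move=> a0; rewrite /= expr0n /= addr0 sqrtr_sqr ger0_norm. Qed.

Lemma complex_nneg z : 0 <= z -> z = (complex.Re z)%:C%C.
Proof. by move=> z0; rewrite RRe_real // ger0_real. Qed.

Lemma Re_nneg z : 0 <= z -> 0 <= complex.Re z.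
Proof. by case: z => a b; rewrite lecE /= => /andP[]. Qed.

Lemma Re_sum (I : finType) (F : I -> C) :
  complex.Re (\sum_i F i) = \sum_i complex.Re (F i).
Proof. by elim/big_rec2: _ => [|i x y _ <-] //; case: (F i); case: y. Qed.

Lemma Re_realM (a : R) z : complex.Re (a%:C%C * z) = a * complex.Re z.
Proof. by case: z => x y /=; rewrite mul0r subr0. Qed.

Lemma Im_realM (a : R) z : complex.Im (a%:C%C * z) = a * complex.Im z.
Proof. by case: z => x y /=; rewrite mul0r addr0. Qed.

Lemma ReD z w : complex.Re (z + w) = complex.Re z + complex.Re w.
Proof. by case: z; case: w. Qed.

Lemma ImD z w : complex.Im (z + w) = complex.Im z + complex.Im w.
Proof. by case: z; case: w. Qed.

Lemma ReB z w : complex.Re (z - w) = complex.Re z - complex.Re w.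
Proof. by case: z; case: w. Qed.

Lemma ImB z w : complex.Im (z - w) = complex.Im z - complex.Im w.
Proof. by case: z; case: w. Qed.

Lemma Im_sum (I : finType) (F : I -> C) :
  complex.Im (\sum_i F i) = \sum_i complex.Im (F i).
Proof. by elim/big_rec2: _ => [|i x y _ <-] //; case: (F i); case: y. Qed.

Lemma complex_eq z w :
  complex.Re z = complex.Re w -> complex.Im z = complex.Im w -> z = w.
Proof. by case: z => a b; case: w => c d /= -> ->. Qed.

End Modulus.

(** Cauchy-Schwarz with [d^2 <= t e] in place of roots or quotients, so that weights may vanish.
    After doubling, both sides compare term by term: [d_i d_j] is at most the geometric mean of
    [t_i e_j] and [t_j e_i], hence at most their arithmetic mean. *)
Lemma sum_sqr_le (R : realType) (I : finType) (d t e : I -> R) :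
  (forall i, 0 <= d i) -> (forall i, 0 <= t i) -> (forall i, 0 <= e i) ->
  (forall i, d i ^+ 2 <= t i * e i) ->
  (\sum_i d i) ^+ 2 <= (\sum_i t i) * (\sum_i e i).
Proof.
move=> d0 t0 e0 dte.
have dd i j : d i * d j *+ 2 <= t i * e j + t j * e i.
  rewrite -[X in X <= _]ger0_norm ?mulrn_wge0 ?mulr_ge0 //.
  rewrite -[X in _ <= X]ger0_norm ?addr_ge0 ?mulr_ge0 //.
  rewrite -ler_sqr ?nnegrE ?normr_ge0 // !real_normK ?num_real //.
  have te1 := mulr_ge0 (t0 i) (e0 j); have te2 := mulr_ge0 (t0 j) (e0 i).
  have h : d i ^+ 2 * d j ^+ 2 <= (t i * e i) * (t j * e j).
    by apply: ler_pM; rewrite ?sqr_ge0.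
  have := sqr_ge0 (t i * e j - t j * e i); nra.
rewrite -(@ler_pMn2r _ 2) //.
have -> : (\sum_i d i) ^+ 2 *+ 2 = \sum_i \sum_j d i * d j *+ 2.
  rewrite expr2 mulr_suml -sumrMnl; apply: eq_bigr => i _.
  by rewrite mulr_sumr -sumrMnl.
have -> : ((\sum_i t i) * (\sum_i e i)) *+ 2 =
    \sum_i \sum_j (t i * e j + t j * e i).
  have te : (\sum_i t i) * (\sum_i e i) = \sum_i \sum_j t i * e j.
    by rewrite mulr_suml; apply: eq_bigr => i _; rewrite mulr_sumr.
  rewrite mulr2n {1}te te [X in _ + X]exchange_big -big_split /=.
  by apply: eq_bigr => i _; rewrite -big_split.
by apply: ler_sum => i _; apply: ler_sum => j _; exact: dd.
Qed.

Section Gram.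
Context {R : realType}.
Local Notation C := R[i].

(** Positivity in factored form. Sums, tensor products and contractions then amount to writing down
    new factors, and the index type need not be an ordinal; [psdP] and [psd_tensP] translate
    back. *)
Definition gram (I : finType) (K : I -> I -> C) : Prop :=
  exists (J : finType) (V : I -> J -> C),
    forall i j, K i j = \sum_k V i k * (V j k)^*.

Lemma eq_gram (I : finType) (K L : I -> I -> C) :
  (forall i j, K i j = L i j) -> gram K -> gram L.
Proof. by move=> KL [J [V KV]]; exists J, V => i j; rewrite -KL. Qed.

Lemma gram_outer (I : finType) (v : I -> C) :
  gram (fun i j => v i * (v j)^*).
Proof. by exists 'I_1, (fun i _ => v i) => i j; rewrite big_ord1. Qed.

Lemma gram_comp (I H : finType) (f : H -> I) (K : I -> I -> C) :
  gram K -> gram (fun i j => K (f i) (f j)).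
Proof. by move=> [J [V KV]]; exists J, (V \o f) => i j; rewrite KV. Qed.

Lemma gramD (I : finType) (K L : I -> I -> C) :
  gram K -> gram L -> gram (fun i j => K i j + L i j).
Proof.
move=> [A [V KV]] [B [W LW]].
exists (A + B)%type, (fun i k => match k with inl a => V i a | inr b => W i b end).
by move=> i j; rewrite KV LW big_sumType.
Qed.

Lemma gram_sum (I H : finType) (K : H -> I -> I -> C) :
  (forall h, gram (K h)) -> gram (fun i j => \sum_h K h i j).
Proof.
move=> gK; elim: (index_enum H) => [|h r IHr].
  exists 'I_0, (fun _ _ => 0) => i j; by rewrite big_nil big_ord0.
apply: eq_gram (gramD (gK h) IHr) => i j; by rewrite big_cons.
Qed.

Lemma gramZ (I : finType) (c : C) (K : I -> I -> C) :
  0 <= c -> gram K -> gram (fun i j => c * K i j).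
Proof.
move=> c0 [J [V KV]]; exists J, (fun i k => sqrtC c * V i k) => i j.
rewrite KV mulr_sumr; apply: eq_bigr => k _.
have rc : (sqrtC c)^* = sqrtC c by rewrite geC0_conj // sqrtC_ge0.
by rewrite rmorphM /= rc mulrACA -expr2 sqrtCK.
Qed.

(* Partial contraction [tr_J (K (1 (x) E))] of a kernel indexed by [I * J]. *)
Lemma gram_contract (I J H : finType) (f : I -> J -> H) (K : H -> H -> C)
    (E : J -> J -> C) :
  gram K -> gram E ->
  gram (fun i i' => \sum_j \sum_j' E j' j * K (f i j) (f i' j')).
Proof.
move=> [A [V KV]] [B [W EW]].
exists (A * B)%type, (fun i k => \sum_j (W j k.2)^* * V (f i j) k.1) => i i'.
transitivity (\sum_j \sum_j' \sum_(k : A * B)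
    (W j k.2)^* * V (f i j) k.1 * (W j' k.2 * (V (f i' j') k.1)^*)).
  apply: eq_bigr => j _; apply: eq_bigr => j' _.
  rewrite EW KV big_distrlr /= exchange_big pair_bigA /=.
  by apply: eq_bigr => -[a b] _ /=; ring.
rewrite (eq_bigr (fun j => \sum_(k : A * B) \sum_j'
    (W j k.2)^* * V (f i j) k.1 * (W j' k.2 * (V (f i' j') k.1)^*))); last first.
  by move=> j _; rewrite exchange_big.
rewrite exchange_big /=; apply: eq_bigr => k _.
rewrite rmorph_sum /= mulr_suml; apply: eq_bigr => j _.
rewrite mulr_sumr; apply: eq_bigr => j' _.
by rewrite rmorphM /= conjCK.
Qed.

Lemma gram_tens (I J : finType) (K : I -> I -> C) (L : J -> J -> C) :
  gram K -> gram L ->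
  gram (fun x y : I * J => K x.1 y.1 * L x.2 y.2).
Proof.
move=> [A [V KV]] [B [W LW]].
exists (A * B)%type, (fun x k => V x.1 k.1 * W x.2 k.2) => x y.
rewrite KV LW big_distrlr /= pair_bigA /=.
by apply: eq_bigr => -[a b] _ /=; rewrite rmorphM /= mulrACA.
Qed.

Lemma gram_diag_ge0 (I : finType) (K : I -> I -> C) i : gram K -> 0 <= K i i.
Proof.
by move=> [J [V ->]]; apply: sumr_ge0 => k _; rewrite mul_conjC_ge0.
Qed.

Lemma gram_minor (I : finType) (K : I -> I -> C) i j : gram K ->
  normc (K i j) ^+ 2 <= complex.Re (K i i) * complex.Re (K j j).
Proof.
move=> [J [V KV]].
have diag a : complex.Re (K a a) = \sum_k normc (V a k) ^+ 2.
  rewrite KV Re_sum; apply: eq_bigr => k _.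
  by rewrite mul_conjC_normc.
rewrite !diag.
apply: le_trans (_ : (\sum_k normc (V i k) * normc (V j k)) ^+ 2 <= _).
  rewrite ler_sqr ?nnegrE ?normc_ge0 ?sumr_ge0 // => [|k _]; last first.
    by rewrite mulr_ge0 ?normc_ge0.
  rewrite KV; apply: le_trans (normc_le_sum _) _; apply: ler_sum => k _.
  by rewrite ComplexField.Normc.normcM normc_conj.
apply: sum_sqr_le => k; rewrite ?mulr_ge0 ?normc_ge0 ?sqr_ge0 //.
by rewrite exprMn.
Qed.

End Gram.

(** * Positive operators and channels *)

Section Psd.
Context {R : realType}.
Local Notation C := R[i].

Lemma quad_formE n (M : 'M[C]_n) (v : 'cV[C]_n) :
  (v^t* *m M *m v) 0 0 = \sum_i \sum_j (v i 0)^* * M i j * v j 0.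
Proof.
rewrite mxE exchange_big /=; apply: eq_bigr => j _.
rewrite mxE mulr_suml; apply: eq_bigr => i _.
by rewrite !mxE.
Qed.

Lemma gram_psd n (M : 'M[C]_n) : gram (fun i j => M i j) -> psd M.
Proof.
move=> [J [V MV]] v; rewrite quad_formE.
have -> : \sum_i \sum_j (v i 0)^* * M i j * v j 0 =
    \sum_k (\sum_i (v i 0)^* * V i k) * (\sum_i (v i 0)^* * V i k)^*.
  transitivity (\sum_i \sum_j \sum_k
      ((v i 0)^* * V i k) * ((v j 0)^* * V j k)^*).
    apply: eq_bigr => i _; apply: eq_bigr => j _.
    rewrite MV mulr_sumr mulr_suml; apply: eq_bigr => k _.
    by rewrite rmorphM /= conjCK; ring.
  rewrite (eq_bigr _ (fun i _ => exchange_big _ _ _ _ _ _)) exchange_big /=.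
  apply: eq_bigr => k _; rewrite rmorph_sum mulr_suml; apply: eq_bigr => i _.
  by rewrite mulr_sumr.
by apply: sumr_ge0 => k _; rewrite mul_conjC_ge0.
Qed.

(** The order of [C] makes the quadratic form real. Its values at [e_i + c e_j], [e_i] and [c e_j]
    show that [c M_ij + c^* M_ji] is real; [c = 1] relates the imaginary parts and [c = 'i] the real
    parts. *)
Lemma psd_conj n (M : 'M[C]_n) i j : psd M -> M j i = (M i j)^*.
Proof.
move=> psdM; have [->|ij] := eqVneq i j.
  pose e : 'cV[C]_n := delta_mx j 0.
  suff -> : M j j = (e^t* *m M *m e) 0 0.
    by rewrite geC0_conj.
  rewrite -mulmxA -colE.
  have -> : e^t* = delta_mx 0 j.
    by apply/matrixP => k l; rewrite !mxE andbC conjC_nat.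
  by rewrite -rowE !mxE.
have offdiag (c : C) : complex.Im (c * M i j + c^* * M j i) = 0.
  have qf (u : 'cV[C]_n) : (forall k, k != i -> k != j -> u k 0 = 0) ->
      (u^t* *m M *m u) 0 0 =
      (u i 0)^* * M i i * u i 0 + (u i 0)^* * M i j * u j 0 +
      ((u j 0)^* * M j i * u i 0 + (u j 0)^* * M j j * u j 0).
    move=> u0.
    have sum2 (F : 'I_n -> C) : (forall k, k != i -> k != j -> F k = 0) ->
        \sum_k F k = F i + F j.
      move=> F0; rewrite (bigD1 i) // (bigD1 j) 1?eq_sym //=.
      by rewrite big1 ?addr0 // => k /andP[ki kj]; exact: F0.
    rewrite quad_formE sum2 => [|k ki kj]; last first.
      by rewrite big1 // => l _; rewrite u0 // rmorph0 !mul0r.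
    by rewrite !sum2 // => k ki kj; rewrite (u0 k) // mulr0.
  pose e (a b : C) : 'cV[C]_n :=
    \col_k (if k == i then a else if k == j then b else 0).
  have ei a b : e a b i 0 = a by rewrite mxE eqxx.
  have ej a b : e a b j 0 = b by rewrite mxE eq_sym (negbTE ij) eqxx.
  have eP a b k : k != i -> k != j -> e a b k 0 = 0.
    by move=> /negbTE ki /negbTE kj; rewrite mxE ki kj.
  have real00 a b := ger0_Im (psdM (e a b)).
  have := real00 1 c; have := real00 1 0; have := real00 0 c.
  rewrite !qf ?ei ?ej; [|exact: eP..].
  rewrite !rmorph1 !rmorph0 !(mul0r, mulr0, mul1r, mulr1, add0r, addr0).
  rewrite !ImD => h1 h2; rewrite h1 h2 add0r addr0 => h3.
  by rewrite [c * _]mulrC.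
have := offdiag 1; have := offdiag 'i%C.
case: (M i j) => a b; case: (M j i) => c d /=.
move=> h1 h2.
suff [-> ->] : c = a /\ d = - b by [].
by split; move: h1 h2; rewrite !(mul0r, mul1r, oppr0, subr0, add0r, addr0); lra.
Qed.

Lemma psd_normalmx n (M : 'M[C]_n) : psd M -> M \is normalmx.
Proof.
move=> psdM; apply/normalmxP; suff -> : M^t* = M by [].
by apply/matrixP => i j; rewrite !mxE -psd_conj.
Qed.

Lemma psd_spectral n (M : 'M[C]_n) : psd M ->
  M = (spectralmx M)^t* *m diag_mx (spectral_diag M) *m spectralmx M.
Proof.
by move=> /psd_normalmx /orthomx_spectralP; rewrite invmx_unitary //
  spectral_unitarymx.
Qed.

Lemma psd_spectral_diag_ge0 n (M : 'M[C]_n) k :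
  psd M -> 0 <= spectral_diag M 0 k.
Proof.
move=> psdM; have MPD := psd_spectral psdM.
set P := spectralmx M in MPD *; set D := spectral_diag M in MPD *.
have PP : P *m P^t* = 1%:M by apply/unitarymxP; exact: spectral_unitarymx.
have := psdM ((row k P)^t*); rewrite trmxCK.
have -> : (row k P *m M *m (row k P)^t*) 0 0 = (P *m M *m P^t*) k k.
  by rewrite -row_mul !mxE; apply: eq_bigr => l _; rewrite !mxE.
rewrite MPD !mulmxA PP mul1mx -mulmxA PP mulmx1.
by rewrite mxE eqxx mulr1n.
Qed.

Lemma mxtrace_psd_spectral n (M : 'M[C]_n) :
  psd M -> \tr M = \sum_k spectral_diag M 0 k.
Proof.
move=> psdM; rewrite {1}(psd_spectral psdM) mxtrace_mulC mulmxA.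
have /unitarymxP -> := spectral_unitarymx M.
by rewrite mul1mx mxtrace_diag.
Qed.

Lemma psd_gram_ord n (M : 'M[C]_n) : psd M ->
  exists V : 'I_n -> 'I_n -> C, forall i j, M i j = \sum_k V i k * (V j k)^*.
Proof.
move=> psdM; set P := spectralmx M; set D := spectral_diag M.
exists (fun i k => (P k i)^* * sqrtC (D 0 k)) => i j.
rewrite {1}(psd_spectral psdM) mxE; apply: eq_bigr => k _.
have rc : (sqrtC (D 0 k))^* = sqrtC (D 0 k).
  by rewrite geC0_conj // sqrtC_ge0 psd_spectral_diag_ge0.
rewrite mul_mx_diag !mxE rmorphM /= conjCK rc.
by rewrite mulrACA -expr2 sqrtCK -/P -/D; ring.
Qed.

Lemma psd_gram n (M : 'M[C]_n) : psd M -> gram (fun i j => M i j).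
Proof. by move=> /psd_gram_ord[V MV]; exists 'I_n, V. Qed.

Lemma psdP n (M : 'M[C]_n) : psd M <-> gram (fun i j => M i j).
Proof. by split; [exact: psd_gram|exact: gram_psd]. Qed.

Lemma psd_tensP p q (M : 'M[C]_(p * q)) :
  psd M <-> gram (fun x y => M (mxtens_index x) (mxtens_index y)).
Proof.
rewrite psdP; split => [|/(gram_comp (@mxtens_unindex p q))]; first exact: gram_comp.
by apply: eq_gram => i j; rewrite !mxtens_unindexK.
Qed.

Lemma gram_tr (I : finType) (K : I -> I -> C) :
  gram K -> gram (fun i j => K j i).
Proof.
move=> [J [V KV]]; exists J, (fun i k => (V i k)^*) => i j.
by rewrite KV; apply: eq_bigr => k _; rewrite conjCK mulrC.
Qed.

Lemma gram_delta (I : finType) : gram (fun i j : I => (i == j)%:R : C).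
Proof.
exists I, (fun i k => (i == k)%:R) => i j.
rewrite (bigD1 i) //= eqxx mul1r big1 ?addr0 => [|k /negbTE ki].
  by rewrite conjC_nat eq_sym.
by rewrite eq_sym ki mul0r.
Qed.

Lemma gram_ptrace (I J H : finType) (f : I -> J -> H) (K : H -> H -> C) :
  gram K -> gram (fun i i' => \sum_j K (f i j) (f i' j)).
Proof.
move=> gK; apply: eq_gram (gram_contract f gK (gram_delta J)) => i i'.
apply: eq_bigr => j _; rewrite (bigD1 j) //= eqxx mul1r big1 ?addr0 //.
by move=> k /negbTE kj; rewrite kj mul0r.
Qed.

Lemma sum_mxtens (V : nmodType) p q (F : 'I_(p * q) -> V) :
  \sum_k F k = \sum_i \sum_j F (mxtens_index (i, j)).
Proof.
rewrite pair_bigA /= (reindex (@mxtens_index p q)) /=.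
  by apply: eq_bigr => -[].
by exists (@mxtens_unindex p q) => k _; rewrite (mxtens_indexK, mxtens_unindexK).
Qed.

Lemma eq_tensmx p q (M N : 'M[C]_(p * q)) :
  (forall x y, M (mxtens_index x) (mxtens_index y) =
               N (mxtens_index x) (mxtens_index y)) -> M = N.
Proof.
move=> MN; apply/matrixP => x y.
by rewrite -(mxtens_unindexK x) -(mxtens_unindexK y).
Qed.

End Psd.

(** * Choi matrices and complete positivity *)

Section Channels.
Context {R : realType}.
Local Notation C := R[i].

Lemma sum_delta_tens p q (F : 'I_p -> 'I_p -> 'M[C]_q) i j b b' :
  (\sum_k \sum_l delta_mx k l *t F k l)
    (mxtens_index (i, b)) (mxtens_index (j, b')) = F i j b b'.
Proof.
rewrite summxE (bigD1 i) //= summxE (bigD1 j) //= tensmxE mxE !eqxx mul1r.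
rewrite !big1 ?addr0 // => [k|k] /negbTE ki.
  rewrite summxE big1 // => l _.
  by rewrite tensmxE mxE eq_sym ki mul0r.
by rewrite tensmxE mxE [j == k]eq_sym ki andbF mul0r.
Qed.

Lemma amplE k p q (S : 'M[C]_p -> 'M[C]_q) (M : 'M[C]_(k * p)) i j b b' :
  ampl S M (mxtens_index (i, b)) (mxtens_index (j, b')) =
  S (tblock M i j) b b'.
Proof. exact: sum_delta_tens. Qed.

Lemma choiE p q (S : 'M[C]_p -> 'M[C]_q) i j b b' :
  choi S (mxtens_index (i, b)) (mxtens_index (j, b')) = S (delta_mx i j) b b'.
Proof. exact: (sum_delta_tens (fun i j => S (delta_mx i j))). Qed.

Lemma tblock_choi p q (S : 'M[C]_p -> 'M[C]_q) i j :
  tblock (choi S) i j = S (delta_mx i j).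
Proof. by apply/matrixP => b b'; rewrite mxE choiE. Qed.

Lemma linear_expand p q (S : 'M[C]_p -> 'M[C]_q) (linS : linear S) M :
  S M = \sum_i \sum_j M i j *: S (delta_mx i j).
Proof.
pose S' : {linear 'M[C]_p -> 'M[C]_q} := HB.pack S
  (GRing.isLinear.Build _ _ _ _ S linS).
rewrite {1}[M]matrix_sum_delta -[S]/(S' : _ -> _) linear_sum.
apply: eq_bigr => i _; rewrite linear_sum; apply: eq_bigr => j _.
by rewrite linearZ.
Qed.

Lemma linear_choiE p q (S : 'M[C]_p -> 'M[C]_q) (linS : linear S) M b b' :
  S M b b' = \sum_i \sum_j M i j *
    choi S (mxtens_index (i, b)) (mxtens_index (j, b')).
Proof.
rewrite linear_expand // summxE; apply: eq_bigr => i _; rewrite summxE.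
by apply: eq_bigr => j _; rewrite mxE choiE.
Qed.

(** The Choi matrix is the image under [ampl S] of the unnormalized maximally entangled projector,
    which is an outer product. *)
Lemma cp_choi_psd p q (S : 'M[C]_p -> 'M[C]_q) :
  completely_positive S -> psd (choi S).
Proof.
move=> /(_ p (\matrix_(x, y)
  (((mxtens_unindex x).1 == (mxtens_unindex x).2)%:R *
   ((mxtens_unindex y).1 == (mxtens_unindex y).2)%:R))).
have -> : forall M : 'M[C]_(p * p), ampl S M = choi S ->
  (psd M -> psd (ampl S M)) = (psd M -> psd (choi S)) by move=> M ->.
  apply; apply: gram_psd.
  apply: eq_gram (gram_outer (fun x : 'I_(p * p) =>
    ((mxtens_unindex x).1 == (mxtens_unindex x).2)%:R)) => x y.
  by rewrite mxE conjC_nat.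
apply: eq_tensmx => -[i b] [j b']; rewrite amplE choiE; congr (S _ _ _).
apply/matrixP => k l; rewrite !mxE !mxtens_indexK /= -natrM mulnb.
by rewrite [k == i]eq_sym [l == j]eq_sym.
Qed.

(* Choi's theorem: [(id (x) S) M] is obtained from [M (x) choi S] by contracting
   the two copies of the input space. *)
Lemma choi_psd_cp p q (S : 'M[C]_p -> 'M[C]_q) (linS : linear S) :
  psd (choi S) -> completely_positive S.
Proof.
move=> /psd_tensP gS k M /psd_tensP gM; apply/psd_tensP.
(* Both copies of the input space sit in the same basis state [a]; contracting with the all-ones
   kernel lets the row value and the column value of [a] range independently. *)
have := gram_contract
  (fun (x : 'I_k * 'I_q) (a : 'I_p) => ((x.1, a), (a, x.2)))
  (gram_tens gM gS) (gram_outer (fun _ => 1)).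
apply: eq_gram => -[i b] [j b'] /=; rewrite amplE (linear_choiE linS).
apply: eq_bigr => a _; apply: eq_bigr => a' _.
by rewrite rmorph1 !mul1r mxE.
Qed.

(** [S M] is the contraction of the Choi matrix with the transpose of [M], and transposition
    preserves Gram kernels. *)
Lemma psd_linear_image p q (S : 'M[C]_p -> 'M[C]_q) (linS : linear S) M :
  psd (choi S) -> psd M -> psd (S M).
Proof.
move=> /psd_tensP gS /psd_gram gM; apply: gram_psd.
have := gram_contract (fun (b : 'I_q) (a : 'I_p) => (a, b)) gS (gram_tr gM).
by apply: eq_gram => b b'; rewrite (linear_choiE linS).
Qed.

Lemma channel_density p q (S : 'M[C]_p -> 'M[C]_q) rho :
  channel S -> density rho -> density (S rho).
Proof.
move=> [linS cpS trS] [psdr tr1]; split; last by rewrite trS.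
exact: psd_linear_image (cp_choi_psd cpS) psdr.
Qed.

End Channels.

(** * Trace norm *)

Section TraceNorm.
Context {R : realType}.
Local Notation C := R[i].

(** The working norm: its triangle inequality and its multiplicativity on tensor products are
    immediate. In the fixed dimensions of the problem it is equivalent to [trnorm], which occurs
    only in the hypotheses on the loss and on the convergence. *)
Definition l1norm m n (A : 'M[C]_(m, n)) : R := \sum_i \sum_j normc (A i j).

Definition frob2 m n (A : 'M[C]_(m, n)) : R :=
  \sum_i \sum_j normc (A i j) ^+ 2.

Lemma l1norm_ge0 m n (A : 'M[C]_(m, n)) : 0 <= l1norm A.
Proof. by do 2!apply: sumr_ge0 => ? _; exact: normc_ge0. Qed.

Lemma frob2_ge0 m n (A : 'M[C]_(m, n)) : 0 <= frob2 A.
Proof. by do 2!apply: sumr_ge0 => ? _; exact: sqr_ge0. Qed.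

Lemma entry_le_l1norm m n (A : 'M[C]_(m, n)) i j : normc (A i j) <= l1norm A.
Proof.
rewrite /l1norm (bigD1 i) //= (bigD1 j) //= -addrA lerDl addr_ge0 //.
  by apply: sumr_ge0 => ? _; exact: normc_ge0.
by do 2!apply: sumr_ge0 => ? _; exact: normc_ge0.
Qed.

Lemma entry_le_frob2 m n (A : 'M[C]_(m, n)) i j :
  normc (A i j) ^+ 2 <= frob2 A.
Proof.
rewrite /frob2 (bigD1 i) //= (bigD1 j) //= -addrA lerDl addr_ge0 //.
  by apply: sumr_ge0 => ? _; exact: sqr_ge0.
by do 2!apply: sumr_ge0 => ? _; exact: sqr_ge0.
Qed.

Lemma l1norm_sum m n (I : finType) (A : I -> 'M[C]_(m, n)) :
  l1norm (\sum_k A k) <= \sum_k l1norm (A k).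
Proof.
rewrite /l1norm [leRHS]exchange_big; apply: ler_sum => i _.
rewrite [leRHS]exchange_big; apply: ler_sum => j _.
by rewrite summxE; exact: normc_le_sum.
Qed.

Lemma l1norm_tens m n p q (A : 'M[C]_(m, n)) (B : 'M[C]_(p, q)) :
  l1norm (A *t B) = l1norm A * l1norm B.
Proof.
rewrite /l1norm sum_mxtens mulr_suml; apply: eq_bigr => i _.
rewrite mulr_sumr; apply: eq_bigr => k _.
rewrite sum_mxtens mulr_suml; apply: eq_bigr => j _.
rewrite mulr_sumr; apply: eq_bigr => l _.
by rewrite tensmxE ComplexField.Normc.normcM.
Qed.

Lemma sum_sqr_le_sqr_sum (I : finType) (s : I -> R) :
  (forall i, 0 <= s i) -> \sum_i s i ^+ 2 <= (\sum_i s i) ^+ 2.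
Proof.
move=> s0; rewrite [leRHS]expr2 mulr_suml; apply: ler_sum => i _.
rewrite expr2 ler_wpM2l // (bigD1 i) //= lerDl.
by apply: sumr_ge0.
Qed.

Lemma sqr_sum_le (I : finType) (s : I -> R) :
  (forall i, 0 <= s i) -> (\sum_i s i) ^+ 2 <= #|I|%:R * \sum_i s i ^+ 2.
Proof.
move=> s0; have -> : #|I|%:R = \sum_(i : I) (1 : R) by rewrite sumr_const.
by apply: sum_sqr_le => // i; rewrite ?sqr_ge0 // mul1r.
Qed.

Lemma frob2_le_l1norm m n (A : 'M[C]_(m, n)) : frob2 A <= l1norm A ^+ 2.
Proof.
rewrite /frob2 /l1norm !pair_bigA /=.
by apply: sum_sqr_le_sqr_sum => k; exact: normc_ge0.
Qed.

Lemma l1norm_le_frob2 m n (A : 'M[C]_(m, n)) :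
  l1norm A ^+ 2 <= (m * n)%:R * frob2 A.
Proof.
rewrite /frob2 /l1norm !pair_bigA /=.
apply: le_trans (sqr_sum_le _) _ => [k|]; first exact: normc_ge0.
by rewrite card_prod !card_ord.
Qed.

Lemma psd_mulCmx m n (A : 'M[C]_(m, n)) : psd (A^t* *m A).
Proof.
apply: gram_psd; exists 'I_m, (fun i k => (A k i)^*) => i j.
by rewrite mxE; apply: eq_bigr => k _; rewrite !mxE conjCK.
Qed.

(** The [s k] are the singular values. This is all that is used of the trace norm: comparing the sum
    of the [s k] with the sum of their squares yields the equivalence with [l1norm]. *)
Lemma trnormE n (A : 'M[C]_n) : exists s : 'I_n -> R,
  [/\ forall k, 0 <= s k, trnorm A = \sum_k s k & \sum_k s k ^+ 2 = frob2 A].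
Proof.
set H := A^t* *m A; have pH : psd H := psd_mulCmx A.
have l0 k := psd_spectral_diag_ge0 k pH.
have r0 k : 0 <= sqrtC (spectral_diag H 0 k) by rewrite sqrtC_ge0.
exists (fun k => complex.Re (sqrtC (spectral_diag H 0 k))); split.
- by move=> k; exact: Re_nneg.
- by rewrite /trnorm Re_sum.
have -> : frob2 A = complex.Re (\tr H).
  rewrite /frob2 exchange_big Re_sum; apply: eq_bigr => j _.
  rewrite mxE Re_sum; apply: eq_bigr => i _.
  by rewrite !mxE mulrC mul_conjC_normc.
rewrite (mxtrace_psd_spectral pH) Re_sum; apply: eq_bigr => k _.
rewrite -[spectral_diag H 0 k in RHS]sqrtCK {2}(complex_nneg (r0 k)).
by rewrite -rmorphXn.
Qed.

Lemma trnorm_ge0 n (A : 'M[C]_n) : 0 <= trnorm A.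
Proof. by have [s [s0 -> _]] := trnormE A; apply: sumr_ge0. Qed.

Lemma entry_le_trnorm n (A : 'M[C]_n) i j : normc (A i j) <= trnorm A.
Proof.
rewrite -ler_sqr ?nnegrE ?normc_ge0 ?trnorm_ge0 //.
apply: le_trans (entry_le_frob2 A i j) _.
by have [s [s0 -> <-]] := trnormE A; exact: sum_sqr_le_sqr_sum.
Qed.

Lemma trnorm_le_l1norm n (A : 'M[C]_n) : trnorm A <= n%:R * l1norm A.
Proof.
rewrite -ler_sqr ?nnegrE ?trnorm_ge0 ?mulr_ge0 ?l1norm_ge0 ?ler0n //.
have [s [s0 -> sA]] := trnormE A.
apply: le_trans (sqr_sum_le s0) _; rewrite card_ord sA exprMn.
apply: ler_pM; rewrite ?frob2_ge0 ?ler0n ?frob2_le_l1norm //.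
by rewrite -natrX ler_nat; case: (n) => // k; rewrite leq_pmulr.
Qed.

End TraceNorm.

(** * The separable cone is closed *)

Section ComplexLimits.
Context {R : realType}.
Local Notation C := R[i].
Context (F : set_system nat).
Implicit Types u v : nat -> C.

Definition cvgc u (a : C) : Prop :=
  (fun j => complex.Re (u j)) @ F --> complex.Re a /\
  (fun j => complex.Im (u j)) @ F --> complex.Im a.

Context {FF : ProperFilter F}.

Lemma cvgc_cst (a : C) : cvgc (fun=> a) a.
Proof. by split; exact: cvg_cst. Qed.

Lemma cvgcD u v a b :
  cvgc u a -> cvgc v b -> cvgc (fun j => u j + v j) (a + b).
Proof.
move=> [u1 u2] [v1 v2]; split.
  rewrite [X in X @ _](_ : _ = (fun j => complex.Re (u j) + complex.Re (v j))).
    rewrite ReD; exact: cvgD.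
  by apply/funext => j; case: (u j); case: (v j).
rewrite [X in X @ _](_ : _ = (fun j => complex.Im (u j) + complex.Im (v j))).
  rewrite ImD; exact: cvgD.
by apply/funext => j; case: (u j); case: (v j).
Qed.

Lemma cvgcM u v a b :
  cvgc u a -> cvgc v b -> cvgc (fun j => u j * v j) (a * b).
Proof.
move=> [u1 u2] [v1 v2]; split.
  rewrite [X in X @ _](_ : _ = (fun j => complex.Re (u j) * complex.Re (v j) -
    complex.Im (u j) * complex.Im (v j))).
    have -> : complex.Re (a * b) = complex.Re a * complex.Re b -
      complex.Im a * complex.Im b by case: (a); case: (b).
    by apply: cvgB; apply: cvgM.
  by apply/funext => j; case: (u j); case: (v j).
rewrite [X in X @ _](_ : _ = (fun j => complex.Re (u j) * complex.Im (v j) +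
  complex.Im (u j) * complex.Re (v j))).
  have -> : complex.Im (a * b) = complex.Re a * complex.Im b +
    complex.Im a * complex.Re b by case: (a); case: (b).
  by apply: cvgD; apply: cvgM.
by apply/funext => j; case: (u j); case: (v j).
Qed.

Lemma cvgc_conj u a : cvgc u a -> cvgc (fun j => (u j)^*) (a^*).
Proof.
move=> [u1 u2]; split.
  rewrite [X in X @ _](_ : _ = (fun j => complex.Re (u j))).
    by case: (a) u1.
  by apply/funext => j; case: (u j).
rewrite [X in X @ _](_ : _ = (fun j => - complex.Im (u j))).
  have -> : complex.Im a^* = - complex.Im a by case: (a).
  exact: cvgN.
by apply/funext => j; case: (u j).
Qed.

Lemma cvgc_sum (I : finType) (u : I -> nat -> C) (a : I -> C) :
  (forall i, cvgc (u i) (a i)) ->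
  cvgc (fun j => \sum_i u i j) (\sum_i a i).
Proof.
move=> ua; elim: (index_enum I) => [|i r IHr].
  rewrite big_nil [X in cvgc X](_ : _ = fun=> 0); first exact: cvgc_cst.
  by apply/funext => j; rewrite big_nil.
rewrite big_cons [X in cvgc X](_ : _ = fun j => u i j + \sum_(k <- r) u k j).
  exact: cvgcD.
by apply/funext => j; rewrite big_cons.
Qed.

Lemma cvgc_unique u a b : cvgc u a -> cvgc u b -> a = b.
Proof.
by move=> [u1 u2] [v1 v2]; apply: complex_eq;
  [exact: cvg_unique u1 v1|exact: cvg_unique u2 v2].
Qed.

End ComplexLimits.

(** * Limits of bounded sequences along an ultrafilter *)

Section UltraLimits.
Context {R : realType}.
Local Notation C := R[i].

(** Compactness of the segment gives a cluster point. An ultrafilter contains each set or its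
    complement, so it converges to each of its cluster points. *)
Lemma bounded_cvg_ultra (U : set_system nat) (UU : UltraFilter U)
    (x : nat -> R) B :
  (forall j, `|x j| <= B) -> exists l : R, x @ U --> l.
Proof.
move=> xB; have [|l [_ cl]] := @segment_compact R (- B) B (x @ U) _.
  by apply: (@filterE _ U) => j; rewrite /= in_itv /= -ler_norml.
exists l => A Al.
have [//|UA] := in_ultra_setVsetC (x @^-1` A) UU.
by have [y [nAy Ay]] := cl (~` A) A UA Al.
Qed.

Lemma normc_ge_Re (z : C) : `|complex.Re z| <= normc z.
Proof.
rewrite -ler_sqr ?nnegrE ?normc_ge0 // real_normK ?num_real //.
by rewrite normc_sqr lerDl sqr_ge0.
Qed.

Lemma normc_ge_Im (z : C) : `|complex.Im z| <= normc z.
Proof.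
rewrite -ler_sqr ?nnegrE ?normc_ge0 // real_normK ?num_real //.
by rewrite normc_sqr lerDr sqr_ge0.
Qed.

Lemma bounded_cvgc_ultra (U : set_system nat) (UU : UltraFilter U)
    (x : nat -> C) B :
  (forall j, normc (x j) <= B) -> exists l, cvgc U x l.
Proof.
move=> xB.
have [|a xa] := @bounded_cvg_ultra U UU (fun j => complex.Re (x j)) B.
  by move=> j; apply: le_trans (xB j); exact: normc_ge_Re.
have [|b xb] := @bounded_cvg_ultra U UU (fun j => complex.Im (x j)) B.
  by move=> j; apply: le_trans (xB j); exact: normc_ge_Im.
by exists (Complex a b).
Qed.

End UltraLimits.

(** * Product decompositions of bounded length *)

Section Separable.
Context {R : realType}.
Local Notation C := R[i].

Definition ketbra n (v : 'cV[C]_n) : 'M[C]_n := v *m v^t*.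

Lemma ketbraE n (v : 'cV[C]_n) i j : ketbra v i j = v i 0 * (v j 0)^*.
Proof. by rewrite mxE big_ord1 !mxE. Qed.

Lemma ketbra0 n : ketbra (0 : 'cV[C]_n) = 0.
Proof. by rewrite /ketbra mul0mx. Qed.

Lemma ketbra_psd n (v : 'cV[C]_n) : psd (ketbra v).
Proof.
apply: gram_psd; apply: eq_gram (gram_outer (fun i => v i 0)) => i j.
by rewrite ketbraE.
Qed.

Lemma ketbraZ n (r : R) (v : 'cV[C]_n) :
  ketbra (r%:C%C *: v) = (r ^+ 2)%:C%C *: ketbra v.
Proof.
apply/matrixP => i j; rewrite ketbraE !mxE big_ord1 !mxE rmorphM /=.
have -> : (r%:C%C)^* = r%:C%C :> C by rewrite conj_Creal // complex_real.
by rewrite rmorphXn /=; ring.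
Qed.

Lemma mxtrace_ketbra n (v : 'cV[C]_n) : \tr (ketbra v) = (frob2 v)%:C%C.
Proof.
rewrite /mxtrace /frob2 rmorph_sum; apply: eq_bigr => i _.
by rewrite ketbraE big_ord1 mul_conjC_normc.
Qed.

Lemma psd_ketbra_sum n (P : 'M[C]_n) :
  psd P -> exists V : 'I_n -> 'cV[C]_n, P = \sum_k ketbra (V k).
Proof.
move=> /psd_gram_ord[V PV]; exists (fun k => \col_i V i k).
apply/matrixP => i j; rewrite PV summxE; apply: eq_bigr => k _.
by rewrite ketbraE !mxE.
Qed.

Lemma separable_fin p q (J : finType) (P : J -> 'M[C]_p) (Q : J -> 'M[C]_q) :
  (forall j, psd (P j)) -> (forall j, psd (Q j)) ->
  separable (\sum_j P j *t Q j).
Proof.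
move=> psdP psdQ.
exists #|J|, (fun k => P (enum_val k)), (fun k => Q (enum_val k)).
by split=> //; rewrite (big_enum_val (fun j => P j *t Q j)).
Qed.

Lemma separableD p q (M N : 'M[C]_(p * q)) :
  separable M -> separable N -> separable (M + N).
Proof.
move=> [m [P [Q [pP pQ ->]]]] [n [P' [Q' [pP' pQ' ->]]]].
have := @separable_fin p q ('I_m + 'I_n)%type
  (fun k => match k with inl i => P i | inr j => P' j end)
  (fun k => match k with inl i => Q i | inr j => Q' j end).
by rewrite big_sumType; apply=> -[].
Qed.

Lemma separable_sum p q (J : finType) (M : J -> 'M[C]_(p * q)) :
  (forall j, separable (M j)) -> separable (\sum_j M j).
Proof.
move=> sM; elim/big_ind: _ => //; last exact: separableD.
exists 0, (fun _ => 0), (fun _ => 0); split=> [[]//|[]//|].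
by rewrite big_ord0.
Qed.

Lemma tensmx_suml p q (J : finType) (A : J -> 'M[C]_p) (B : 'M[C]_q) :
  (\sum_j A j) *t B = \sum_j A j *t B.
Proof.
apply/matrixP => x y; rewrite mxE !summxE mulr_suml.
by apply: eq_bigr => j _; rewrite mxE.
Qed.

Lemma tensmx_sumr p q (J : finType) (A : 'M[C]_p) (B : J -> 'M[C]_q) :
  A *t (\sum_j B j) = \sum_j A *t B j.
Proof.
apply/matrixP => x y; rewrite mxE !summxE mulr_sumr.
by apply: eq_bigr => j _; rewrite mxE.
Qed.

Lemma tensmxZl p q a (A : 'M[C]_p) (B : 'M[C]_q) :
  (a *: A) *t B = a *: (A *t B).
Proof. by apply/matrixP => x y; rewrite !mxE mulrA. Qed.

Lemma tensmxZr p q a (A : 'M[C]_p) (B : 'M[C]_q) :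
  A *t (a *: B) = a *: (A *t B).
Proof. by apply/matrixP => x y; rewrite !mxE mulrCA. Qed.

Lemma mxtrace_tens p q (A : 'M[C]_p) (B : 'M[C]_q) :
  \tr (A *t B) = \tr A * \tr B.
Proof.
rewrite /mxtrace sum_mxtens mulr_suml; apply: eq_bigr => i _.
by rewrite mulr_sumr; apply: eq_bigr => j _; rewrite tensmxE.
Qed.

(** The real dimension of the complex matrices of order [p * q], written as the width of the row
    that juxtaposes real and imaginary parts. *)
Definition real_dim p q : nat := (p * q * (p * q) + p * q * (p * q))%N.

(** Vectors may be zero, so this means at most [n] product terms and is monotone in [n]. *)
Definition ketbra_rank p q n (M : 'M[C]_(p * q)) : Prop :=
  exists (v : 'I_n -> 'cV[C]_p) (w : 'I_n -> 'cV[C]_q),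
    M = \sum_k ketbra (v k) *t ketbra (w k).

Lemma ketbra_rank_fin p q (J : finType) (v : J -> 'cV[C]_p) (w : J -> 'cV[C]_q) :
  ketbra_rank #|J| (\sum_j ketbra (v j) *t ketbra (w j)).
Proof.
exists (v \o enum_val), (w \o enum_val).
by rewrite (big_enum_val (fun j => ketbra (v j) *t ketbra (w j))).
Qed.

Lemma separable_ketbra p q (M : 'M[C]_(p * q)) :
  separable M -> exists n, ketbra_rank n M.
Proof.
move=> [n [P [Q [pP pQ ->]]]].
have [V PV] := choice (fun k => psd_ketbra_sum (pP k)).
have [W QW] := choice (fun k => psd_ketbra_sum (pQ k)).
have := ketbra_rank_fin (fun j : 'I_n * ('I_p * 'I_q) => V j.1 j.2.1)
  (fun j => W j.1 j.2.2).
rewrite -(pair_bigA _ (fun k ij => ketbra (V k ij.1) *t ketbra (W k ij.2))) /=.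
rewrite [X in ketbra_rank _ X](_ : _ = \sum_k P k *t Q k); first by eexists; eauto.
apply: eq_bigr => k _.
rewrite -(pair_bigA _ (fun i j => ketbra (V k i) *t ketbra (W k j))) /=.
by rewrite PV QW tensmx_suml; apply: eq_bigr => i _; rewrite tensmx_sumr.
Qed.

Lemma ketbra_rank_separable p q n (M : 'M[C]_(p * q)) :
  ketbra_rank n M -> separable M.
Proof.
by move=> [v [w ->]]; apply: separable_fin => j; exact: ketbra_psd.
Qed.

Lemma ketbra_rankS p q n (M : 'M[C]_(p * q)) :
  ketbra_rank n M -> ketbra_rank n.+1 M.
Proof.
move=> [v [w ->]]; exists (fun k => oapp v 0 (unlift ord0 k)),
  (fun k => oapp w 0 (unlift ord0 k)).
rewrite big_ord_recl unlift_none /= ketbra0 tens0mx add0r.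
by apply: eq_bigr => k _; rewrite liftK.
Qed.

(* Caratheodory: a linear relation between the n.+1 product states, scaled so
   that its largest coefficient is 1, is subtracted to kill one of them. *)
Lemma ketbra_rank_pred p q n (M : 'M[C]_(p * q)) :
  (real_dim p q <= n)%N ->
  ketbra_rank n.+1 M -> ketbra_rank n M.
Proof.
move=> len [v [w ->]]; pose N k := ketbra (v k) *t ketbra (w k).
pose U := \matrix_(k < n.+1) row_mx (mxvec (map_mx (@complex.Re R) (N k)))
  (mxvec (map_mx (@complex.Im R) (N k))).
have [l lU l0] : exists2 l : 'rV[R]_n.+1, l *m U = 0 & l != 0.
  suff /rowV0Pn[l /sub_kermxP lU l0] : kermx U != 0 by exists l.
  rewrite -mxrank_eq0 mxrank_ker subn_eq0 -ltnNge ltnS.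
  exact: leq_trans (rank_leq_col U) len.
(* Up to a change of sign some coefficient is positive; then so is the largest one, and dividing by
   it keeps inequalities. *)
wlog [k lk] : l lU l0 / exists k, 0 < l 0 k => [hwlog|].
  have [k lk] : exists k, l 0 k != 0 by exact/rV0Pn.
  have [lk0|] := ltP 0 (l 0 k); first by apply: (hwlog l) => //; exists k.
  rewrite le_eqVlt (negbTE lk) /= => lk0; apply: (hwlog (- l)).
  - by rewrite mulNmx lU oppr0.
  - by rewrite oppr_eq0.
  - by exists k; rewrite mxE oppr_gt0.
have lUc c : \sum_k l 0 k * U k c = 0.
  by have /rowP/(_ c) := lU; rewrite !mxE.
have lN : \sum_k (l 0 k)%:C%C *: N k = 0.
  apply/matrixP => x y; rewrite summxE mxE; apply: complex_eq.
    apply: etrans (lUc (lshift _ (mxvec_index x y))); rewrite Re_sum.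
    apply: eq_bigr => i _; rewrite [X in complex.Re X]mxE Re_realM [U _ _]mxE.
    by rewrite row_mxEl mxvecE [map_mx _ _ _ _]mxE.
  apply: etrans (lUc (rshift _ (mxvec_index x y))); rewrite Im_sum.
  apply: eq_bigr => i _; rewrite [X in complex.Im X]mxE Im_realM [U _ _]mxE.
  by rewrite row_mxEr mxvecE [map_mx _ _ _ _]mxE.
pose m := [arg max_(i > k) l 0 i]%O.
have lm i : l 0 i <= l 0 m.
  by rewrite /m; case: Order.TotalTheory.arg_maxP => //= j _; apply.
have m0 : 0 < l 0 m by exact: lt_le_trans (lm k).
pose c i := 1 - l 0 i / l 0 m.
have c0 i : 0 <= c i by rewrite subr_ge0 ler_pdivrMr // mul1r.
(* The new coefficients [c i] are nonnegative, so their roots can be moved into the vectors;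
   [c m = 0] removes the term [m]. *)
exists (fun i => (Num.sqrt (c (lift m i)))%:C%C *: v (lift m i)),
  (fun i => w (lift m i)).
transitivity (\sum_i (c i)%:C%C *: N i).
  have -> : \sum_i (c i)%:C%C *: N i =
      \sum_i N i - (l 0 m)^-1%:C%C *: \sum_i (l 0 i)%:C%C *: N i.
    rewrite scaler_sumr -sumrB; apply: eq_bigr => i _.
    by rewrite /c rmorphB scalerBl rmorph1 scale1r mulrC rmorphM scalerA.
  by rewrite lN scaler0 subr0.
rewrite (bigD1_ord m) //= {1}/c divff ?gt_eqF // subrr scale0r add0r.
by apply: eq_bigr => i _; rewrite ketbraZ sqr_sqrtr // tensmxZl.
Qed.

Lemma separable_ketbra_bounded p q (M : 'M[C]_(p * q)) : separable M ->
  ketbra_rank (real_dim p q) M.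
Proof.
move=> /separable_ketbra[n]; set D := real_dim p q.
have [nD|/ltnW Dn] := leqP n D.
  by rewrite -(subnK nD); elim: (D - n)%N => // k IHk /IHk /ketbra_rankS.
rewrite -(subnK Dn); elim: (n - D)%N => // k IHk kM; apply: IHk.
by apply: ketbra_rank_pred kM; rewrite leq_addl.
Qed.

Lemma normc_le_frob2 n (v : 'cV[C]_n) i B :
  frob2 v <= B -> normc (v i 0) <= 1 + B.
Proof.
move=> vB; have vi := le_trans (entry_le_frob2 v i 0) vB.
have := normc_ge0 (v i 0); nra.
Qed.

(** A product term bounds neither of its factors, since scalars can move between them. Moving the
    norm of [w k] to [v k] makes the squared norm of [v k] the trace of the term, which is at most
    the trace of [M] because all terms are positive. *)
Lemma separable_ketbra_normalized p q (M : 'M[C]_(p * q)) : separable M ->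
  exists (v : 'I_(real_dim p q) -> 'cV[C]_p)
    (w : 'I_(real_dim p q) -> 'cV[C]_q),
    [/\ M = \sum_k ketbra (v k) *t ketbra (w k),
        forall k, frob2 (w k) <= 1 &
        forall k, frob2 (v k) <= complex.Re (\tr M)].
Proof.
move=> /separable_ketbra_bounded[v [w Mvw]].
pose r k := Num.sqrt (frob2 (w k)).
have r2 k : r k ^+ 2 = frob2 (w k) by rewrite sqr_sqrtr // frob2_ge0.
have frobZ n (s : R) (u : 'cV[C]_n) : frob2 (s%:C%C *: u) = s ^+ 2 * frob2 u.
  apply: complexI; rewrite -mxtrace_ketbra ketbraZ mxtraceZ mxtrace_ketbra.
  by rewrite -rmorphM.
have frob0 n (u : 'cV[C]_n) : frob2 u = 0 -> u = 0.
  move=> u0; apply/colP => i; rewrite mxE; apply: ComplexField.Normc.eq0_normc.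
  have := entry_le_frob2 u i 0; rewrite u0 => u1.
  by apply/eqP; rewrite -sqrf_eq0 eq_le u1 sqr_ge0.
exists (fun k => (r k)%:C%C *: v k), (fun k => (r k)^-1%:C%C *: w k); split.
- rewrite Mvw; apply: eq_bigr => k _.
  rewrite !ketbraZ tensmxZl tensmxZr scalerA -rmorphM /=.
  (* If [r k = 0] then [w k = 0], and both terms vanish. *)
  have [rk|rk] := eqVneq (r k) 0.
    by rewrite [w k]frob0 -?r2 ?rk ?expr0n // ketbra0 tensmx0 scaler0.
  by rewrite -exprMn divff // expr1n scale1r.
- move=> k; rewrite frobZ -r2.
  have [->|rk] := eqVneq (r k) 0; first by rewrite invr0 expr0n mul0r ler01.
  by rewrite -exprMn mulVf // expr1n.
- move=> k; rewrite frobZ r2 Mvw (raddf_sum (@mxtrace C (p * q))) Re_sum.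
  rewrite (bigD1 k) //=.
  have trE i : complex.Re (\tr (ketbra (v i) *t ketbra (w i))) =
      frob2 (v i) * frob2 (w i).
    by rewrite mxtrace_tens !mxtrace_ketbra -rmorphM.
  rewrite trE mulrC lerDl; apply: sumr_ge0 => i _.
  by rewrite trE mulr_ge0 ?frob2_ge0.
Qed.

Lemma l1norm_trace n (A : 'M[C]_n) : complex.Re (\tr A) <= l1norm A.
Proof.
rewrite /mxtrace Re_sum; apply: ler_sum => i _.
rewrite (bigD1 i) //= -[leLHS]addr0; apply: lerD.
  exact: le_trans (ler_norm _) (normc_ge_Re _).
by apply: sumr_ge0 => j _; exact: normc_ge0.
Qed.

Theorem separable_closed p q (M : 'M[C]_(p * q)) :
  (forall e, 0 < e -> exists N, separable N /\ l1norm (N - M) <= e) ->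
  separable M.
Proof.
move=> apx; have inv0 j : 0 < j.+1%:R^-1 :> R by rewrite invr_gt0.
have [N NM] := choice (fun j => apx _ (inv0 j)).
have /choice[vw vwP] j := separable_ketbra_normalized (NM j).1.
have [w wP] := choice vwP.
(* A single ultrafilter finer than the tails of [nat] makes all coordinates of all vectors converge
   at once, without extracting successive subsequences. The common length [real_dim p q] makes the
   coordinates finitely many. *)
have [U [UU ooU]] := ultraFilterLemma eventually_filter.
have trN j : complex.Re (\tr (N j)) <= l1norm M + 1.
  have -> : N j = M + (N j - M) by rewrite addrC subrK.
  rewrite raddfD /= ReD.
  apply: lerD; first exact: l1norm_trace.
  apply: le_trans (l1norm_trace _) (le_trans (NM j).2 _).
  by rewrite invf_le1 // ler1n.
have /choice[a aP] (ki : 'I_(real_dim p q) * 'I_p) :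
    exists l, cvgc U (fun j => vw j ki.1 ki.2 0) l.
  apply: (@bounded_cvgc_ultra _ _ _ _ (1 + (l1norm M + 1))) => j.
  have [_ _ vB] := wP j; apply: normc_le_frob2.
  exact: le_trans (vB _) (trN j).
have /choice[b bP] (ki : 'I_(real_dim p q) * 'I_q) :
    exists l, cvgc U (fun j => w j ki.1 ki.2 0) l.
  apply: (@bounded_cvgc_ultra _ _ _ _ (1 + 1)) => j.
  by have [_ wB _] := wP j; apply: normc_le_frob2.
apply: (@ketbra_rank_separable _ _ (real_dim p q)).
exists (fun k => \col_i a (k, i)), (fun k => \col_i b (k, i)).
apply: eq_tensmx => -[i i'] [j j'].
set x := mxtens_index (i, i'); set y := mxtens_index (j, j').
(* Along [U] the entry of [N m] tends to that of [M], and also, by continuity of sums and products,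
   to that of the limit decomposition. *)
apply: (@cvgc_unique _ U _ (fun m => N m x y)).
  have lim0 (f : C -> R) : (forall z z', f (z - z') = f z - f z') ->
      (forall z, `|f z| <= normc z) -> (fun m => f (N m x y)) @ U --> f (M x y).
    move=> fB fn; apply: cvg_trans (_ : (fun m => f (N m x y)) @ \oo --> _).
      by move=> A /ooU.
    apply/cvgrPdist_le => e e0; near=> m.
    rewrite distrC -fB; apply: le_trans (fn _) _.
    have -> : N m x y - M x y = (N m - M) x y by rewrite !mxE.
    apply: le_trans (entry_le_l1norm _ _ _) (le_trans (NM m).2 _).
    by rewrite ltW //; near: m; exact: near_infty_natSinv_lt (PosNum e0).
  by split; apply: lim0 => *; rewrite ?ReB ?ImB ?normc_ge_Re ?normc_ge_Im.
have -> : (fun m => N m x y) =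
    fun m => \sum_k (vw m k i 0 * (vw m k j 0)^* *
                     (w m k i' 0 * (w m k j' 0)^*)).
  apply/funext => m; have [-> _ _] := wP m; rewrite summxE.
  by apply: eq_bigr => k _; rewrite tensmxE !ketbraE.
rewrite summxE; apply: cvgc_sum => k; rewrite tensmxE !ketbraE !mxE.
apply: cvgcM; apply: cvgcM; try apply: cvgc_conj.
- exact: (aP (k, i)).
- exact: (aP (k, j)).
- exact: (bP (k, i')).
- exact: (bP (k, j')).
Unshelve. all: by end_near. Qed.

End Separable.

(** * An informationally complete measurement *)

Section Povm.
Context {R : realType} (d : nat).
Local Notation C := R[i].

Definition povm_index : finType := ('I_d * 'I_d * 'I_4)%type.

Definition phase (x : povm_index) : C := 'i ^+ x.2.

(* The effects [(1 + (w |i><j| + w^* |j><i|) / 2) / (4 d^2)], w^4 = 1: they sum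
   to the identity and span all operators. *)
Definition effect (x : povm_index) (b b' : 'I_d) : C :=
  (4 * d ^ 2)%:R^-1 * ((b == b')%:R + 2^-1 *
    (phase x * ((b == x.1.1) && (b' == x.1.2))%:R +
     (phase x)^* * ((b == x.1.2) && (b' == x.1.1))%:R)).

(* [tr (E_x Z)] *)
Definition measure_kernel (x : povm_index) (Z : 'I_d -> 'I_d -> C) : C :=
  \sum_b \sum_b' effect x b' b * Z b b'.

(** Over the fourth roots of unity [w] and [w^2] sum to zero, so weighting the outcomes by [w]
    leaves only the term in [w^*], namely [Z i j / 2]. The four phases and the prefactor
    [1 / (4 d^2)] then account for the factor [2 d^2]. *)
Definition dual_frame (x : povm_index) : 'M[C]_d :=
  ((2 * d ^ 2)%:R * phase x) *: delta_mx x.1.1 x.1.2.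

Lemma phase_unit x : phase x * (phase x)^* = 1.
Proof. by rewrite rmorphXn /= conjCi -exprMn mulrN -expr2 sqrCi opprK expr1n. Qed.

Lemma gram_diag (I : finType) (c : I -> C) : (forall i, 0 <= c i) ->
  gram (fun i j => (i == j)%:R * c i).
Proof.
move=> c0; exists I, (fun i k => (i == k)%:R * sqrtC (c k)) => i j.
rewrite (bigD1 i) //= eqxx mul1r big1 ?addr0 => [|k /negbTE ki]; last first.
  by rewrite eq_sym ki !mul0r.
have rc : (sqrtC (c i))^* = sqrtC (c i) by rewrite geC0_conj // sqrtC_ge0.
by rewrite rmorphM /= conjC_nat rc mulrCA -expr2 sqrtCK eq_sym.
Qed.

(** Up to its prefactor the effect is [u u^* / 2], with [u = e_i + w^* e_j], plus the nonnegative
    diagonal matrix [1 - (|i><i| + |j><j|) / 2]; the case [i = j] is included. *)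
Lemma gram_effect x : gram (effect x).
Proof.
case: x => [[i j] k]; apply: gramZ; first by rewrite invr_ge0 ler0n.
pose w := phase (i, j, k).
pose u (b : 'I_d) : C := (b == i)%:R + w^* * (b == j)%:R.
have g1 : gram (fun b b' : 'I_d => (b == b')%:R *
    (2^-1 * ((b != i)%:R + (b != j)%:R) : C)).
  by apply: gram_diag => b; rewrite mulr_ge0 ?addr_ge0 ?invr_ge0 ?ler0n.
have g2 : gram (fun b b' => 2^-1 * (u b * (u b')^*)).
  by apply: gramZ (gram_outer u); rewrite invr_ge0 ler0n.
apply: eq_gram (gramD g1 g2) => b b' /=.
rewrite /u rmorphD rmorphM /= !conjC_nat conjCK -/w.
have ww : w * w^* = 1 := phase_unit (i, j, k).
have negE k' : (b != k')%:R = 1 - (b == k')%:R :> C.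
  by case: (b == k'); rewrite ?subrr ?subr0.
have eqE k' : (b == k')%:R * (b' == k')%:R = (b == b')%:R * (b == k')%:R :> C.
  have [->|bk] := eqVneq b k'; last by rewrite mul0r mulr0.
  by rewrite mulr1 mul1r eq_sym.
rewrite -!mulnb !natrM !negE.
have -> : ((b == i)%:R + w^* * (b == j)%:R) * ((b' == i)%:R + w * (b' == j)%:R)
  = (b == i)%:R * (b' == i)%:R + w * ((b == i)%:R * (b' == j)%:R)
  + w^* * ((b == j)%:R * (b' == i)%:R)
  + (w * w^*) * ((b == j)%:R * (b' == j)%:R) by ring.
by rewrite ww !eqE; field.
Qed.

Lemma sum_delta1 (F : 'I_d -> C) i : \sum_b (b == i)%:R * F b = F i.
Proof.
rewrite (bigD1 i) //= eqxx mul1r big1 ?addr0 // => b /negbTE ->.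
by rewrite mul0r.
Qed.

Lemma measure_kernelE i j k Z :
  measure_kernel (i, j, k) Z = (4 * d ^ 2)%:R^-1 *
    (\sum_b Z b b + 2^-1 * (phase (i, j, k) * Z j i +
                            (phase (i, j, k))^* * Z i j)).
Proof.
rewrite /measure_kernel /effect /=; set w := phase _; set n := _^-1.
transitivity (\sum_b n * (\sum_b' (b' == b)%:R * Z b b' +
    2^-1 * (w * ((b == j)%:R * \sum_b' (b' == i)%:R * Z b b') +
       w^* * ((b == i)%:R * \sum_b' (b' == j)%:R * Z b b')))).
  apply: eq_bigr => b _; rewrite !mulr_sumr -!big_split /= !mulr_sumr -big_split.
  rewrite mulr_sumr; apply: eq_bigr => b' _ /=.
  by rewrite -!mulnb !natrM; ring.
rewrite -mulr_sumr big_split /= -mulr_sumr big_split /= -!mulr_sumr.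
congr (_ * (_ + _ * (_ * _ + _ * _))).
- by apply: eq_bigr => b _; rewrite sum_delta1.
- by rewrite sum_delta1 sum_delta1.
- by rewrite sum_delta1 sum_delta1.
Qed.

Lemma sum_povm (F : povm_index -> C) :
  \sum_x F x = \sum_i \sum_j (F (i, j, 0) + F (i, j, 1) + F (i, j, 2%:R)
    + F (i, j, 3%:R)).
Proof.
transitivity (\sum_i \sum_j \sum_k F (i, j, k)).
  rewrite pair_bigA (pair_bigA _ (fun ij k => F (ij.1, ij.2, k))) /=.
  by apply: eq_bigr => -[[]].
apply: eq_bigr => i _; apply: eq_bigr => j _.
rewrite !big_ord_recl big_ord0 addr0 !addrA.
by do !congr (_ + _); congr F; congr pair; apply: val_inj.
Qed.

Lemma phaseE i j : [/\ phase (i, j, 0) = 1, phase (i, j, 1) = 'i,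
  phase (i, j, 2%:R) = -1 & phase (i, j, 3%:R) = - 'i].
Proof.
rewrite /phase /=; split.
- by rewrite expr0.
- by rewrite expr1.
- by rewrite sqrCi.
- by rewrite exprS sqrCi mulrN1.
Qed.

Lemma measure_kernel_sum Z : \sum_x measure_kernel x Z = \sum_b Z b b.
Proof.
rewrite sum_povm.
transitivity (\sum_(i < d) \sum_(j < d) (d ^ 2)%:R^-1 * \sum_b Z b b).
  apply: eq_bigr => i _; apply: eq_bigr => j _; rewrite !measure_kernelE.
  have [-> -> -> ->] := phaseE i j.
  rewrite !(rmorph1, rmorphN1, rmorphN, conjCi) /= ?conjCi.
  have d0 : (d ^ 2)%:R != 0 :> C.
    by rewrite pnatr_eq0; case: (d) i => [[]|] //.
  by rewrite natrM; move: (d ^ 2)%:R d0 => s d0; field.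
rewrite !sumr_const !card_ord -mulrnA mulnn -[LHS]mulr_natl mulrA.
(* For [d = 0] the inverse of [d ^ 2] is no true inverse, but the trace is an empty sum. *)
have [d0|d0] := posnP d.
  rewrite !big1 ?mulr0 // => b _.
  by suff : (b < 0)%N by []; rewrite -d0 ltn_ord.
by rewrite divff ?mul1r // pnatr_eq0 -lt0n expn_gt0 d0.
Qed.

Lemma measure_kernel_frame Z i j :
  \sum_x measure_kernel x Z * dual_frame x i j = Z i j.
Proof.
rewrite sum_povm.
transitivity (\sum_k \sum_l ((k == i)%:R * ((l == j)%:R * Z k l))).
  apply: eq_bigr => k _; apply: eq_bigr => l _.
  rewrite !measure_kernelE /dual_frame !mxE /= [i == k]eq_sym [j == l]eq_sym.
  have [-> -> -> ->] := phaseE k l.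
  rewrite !(rmorph1, rmorphN1, rmorphN, conjCi) /= ?conjCi -mulnb.
  rewrite (natrM _ 4 (d ^ 2)) (natrM _ 2 (d ^ 2)) (natrM _ (k == i) (l == j)).
  have i2 : 'i * 'i = -1 :> C by rewrite -expr2 sqrCi.
  have d0 : (d ^ 2)%:R != 0 :> C.
    by rewrite pnatr_eq0; case: (d) i => [[]|] //.
  move: (d ^ 2)%:R d0 => s d0; set t := \sum_b Z b b.
  set e := (k == i)%:R; set e' := (l == j)%:R.
  (* The four phases are collected so that ['i * 'i = -1] cancels [Z l k] and leaves [Z k l] with
     total coefficient 1. *)
  transitivity (e * (e' * ((4 * s)^-1 * (2 * s) *
     ((2^-1 * (1 + 'i * 'i) * 2) * Z l k + (2^-1 * (1 - 'i * 'i) * 2) * Z k l)))).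
    by ring.
  by rewrite i2; field.
transitivity (\sum_k (k == i)%:R * \sum_l (l == j)%:R * Z k l).
  by apply: eq_bigr => k _; rewrite mulr_sumr.
by rewrite !sum_delta1.
Qed.

Lemma l1norm_dual_frame x : l1norm (dual_frame x) = (2 * d ^ 2)%:R.
Proof.
rewrite /l1norm (bigD1 x.1.1) //= (bigD1 x.1.2) //=.
have n1 : normc ((2 * d ^ 2)%:R : C) = (2 * d ^ 2)%:R.
  by rewrite -(rmorph_nat (real_complex R)) normc_nneg.
have p1 : normc (phase x) = 1.
  apply/eqP; rewrite -sqrp_eq1 ?normc_ge0 //; apply/eqP; apply: complexI.
  by rewrite -mul_conjC_normc phase_unit.
have e0 a : normc ((2 * d ^ 2)%:R * phase x * a) =
    (2 * d ^ 2)%:R * normc a.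
  by rewrite !ComplexField.Normc.normcM n1 p1 mulr1.
rewrite !big1 ?addr0.
- by rewrite !mxE !eqxx e0 ComplexField.Normc.normc1 mulr1.
- move=> i ij; rewrite big1 // => l _.
  by rewrite !mxE (negbTE ij) e0 ComplexField.Normc.normc0 mulr0.
- move=> l lj; by rewrite !mxE (negbTE lj) andbF e0 ComplexField.Normc.normc0 mulr0.
Qed.

End Povm.

(** * De Finetti bound *)

Section Energy.
Context {R : realType}.
Local Notation C := R[i].

(** For [u x = t x * y x] this is [E (y - E y)^2 = E y^2 - (E y)^2] with unnormalized weights [t].
    The hypothesis makes indices of weight zero contribute nothing. *)
Lemma variance_identity (I : finType) (t u : I -> R) :
  (forall x, t x = 0 -> u x = 0) ->
  \sum_x (u x - t x / (\sum_y t y) * (\sum_y u y)) ^+ 2 / t x =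
  \sum_x u x ^+ 2 / t x - (\sum_y u y) ^+ 2 / (\sum_y t y).
Proof.
move=> tu0; set T := \sum_y t y; set U := \sum_y u y.
transitivity (\sum_x (u x ^+ 2 / t x - 2 * U / T * u x + U ^+ 2 / T ^+ 2 * t x)).
  apply: eq_bigr => x _; have [tx|tx] := eqVneq (t x) 0.
    by rewrite tx (tu0 _ tx) invr0 !mulr0 subr0 addr0.
  have [->|T0] := eqVneq T 0.
    by rewrite expr0n /= !invr0 !mulr0 !mul0r !subr0 addr0.
  by field; rewrite tx T0.
rewrite big_split /= sumrB -!mulr_sumr -/T -/U.
have [->|T0] := eqVneq T 0; last by field.
by rewrite expr0n /= !invr0 !mulr0 !mul0r !subr0 addr0.
Qed.

(** The scalar identity for each real and imaginary part of each entry. With conditional operators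
    as [A x], the right-hand side is the energy gained by the measurement. *)
Lemma frob2_variance (I : finType) n (t : I -> R) (A : I -> 'M[C]_n) :
  (forall x, t x = 0 -> A x = 0) ->
  \sum_x frob2 (A x - (t x / \sum_y t y)%:C%C *: \sum_y A y) / t x =
  \sum_x frob2 (A x) / t x - frob2 (\sum_y A y) / \sum_y t y.
Proof.
move=> tA0; set T := \sum_y t y.
have frobE (B : 'M[C]_n) : frob2 B = \sum_(ij : 'I_n * 'I_n)
    (complex.Re (B ij.1 ij.2) ^+ 2 + complex.Im (B ij.1 ij.2) ^+ 2).
  rewrite /frob2 pair_bigA; apply: eq_bigr => ij _.
  by rewrite normc_sqr.
transitivity (\sum_(ij : 'I_n * 'I_n) (
  (\sum_x complex.Re (A x ij.1 ij.2) ^+ 2 / t x -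
    (\sum_x complex.Re (A x ij.1 ij.2)) ^+ 2 / T) +
  (\sum_x complex.Im (A x ij.1 ij.2) ^+ 2 / t x -
    (\sum_x complex.Im (A x ij.1 ij.2)) ^+ 2 / T))).
  transitivity (\sum_(ij : 'I_n * 'I_n) \sum_x (
    (complex.Re (A x ij.1 ij.2) -
      t x / T * \sum_y complex.Re (A y ij.1 ij.2)) ^+ 2 / t x +
    (complex.Im (A x ij.1 ij.2) -
      t x / T * \sum_y complex.Im (A y ij.1 ij.2)) ^+ 2 / t x)).
    rewrite exchange_big; apply: eq_bigr => x _.
    rewrite frobE mulr_suml; apply: eq_bigr => ij _.
    by rewrite !mxE summxE ReB ImB Re_realM Im_realM Re_sum Im_sum mulrDl.
  apply: eq_bigr => ij _; rewrite big_split /= !variance_identity // => x /tA0 ->;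
  by rewrite mxE.
rewrite big_split /= !sumrB !frobE.
have -> : \sum_x frob2 (A x) / t x = \sum_(ij : 'I_n * 'I_n)
   \sum_x complex.Re (A x ij.1 ij.2) ^+ 2 / t x +
   \sum_(ij : 'I_n * 'I_n) \sum_x complex.Im (A x ij.1 ij.2) ^+ 2 / t x.
  transitivity (\sum_x \sum_(ij : 'I_n * 'I_n)
    (complex.Re (A x ij.1 ij.2) ^+ 2 / t x +
     complex.Im (A x ij.1 ij.2) ^+ 2 / t x)).
    apply: eq_bigr => x _; rewrite frobE mulr_suml; apply: eq_bigr => ij _.
    by rewrite mulrDl.
  rewrite exchange_big -big_split; apply: eq_bigr => ij _ /=.
  by rewrite big_split.
rewrite big_split mulrDl !mulr_suml /= opprD addrACA.
congr (_ + (- _ - _)); apply: eq_bigr => ij _.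
  by rewrite summxE Re_sum.
by rewrite summxE Im_sum.
Qed.

End Energy.

(** * Splitting off the first site of a word *)

Section FfunCons.
Context (d m : nat).

Lemma ffcons0 b (g : {ffun 'I_m -> 'I_d}) : ffcons b g ord0 = b.
Proof. by rewrite ffunE unlift_none. Qed.

Lemma ffcons_lift b (g : {ffun 'I_m -> 'I_d}) j :
  ffcons b g (lift ord0 j) = g j.
Proof. by rewrite ffunE liftK. Qed.

Lemma sum_ffcons (V : nmodType) (F : {ffun 'I_m.+1 -> 'I_d} -> V) :
  \sum_f F f = \sum_b \sum_g F (ffcons b g).
Proof.
rewrite pair_bigA /= (reindex (fun bg => ffcons bg.1 bg.2)) //=.
exists (fun f => (f ord0, [ffun j => f (lift ord0 j)])) => [[b g] _|f _] /=.
  by rewrite ffcons0; congr pair; apply/ffunP => j; rewrite ffunE ffcons_lift.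
apply/ffunP => i; have [j ->|->] := unliftP ord0 i; last by rewrite ffcons0.
by rewrite ffcons_lift ffunE.
Qed.

(** A permutation of the other sites extends to all sites by fixing the first; this is how
    conditioning preserves exchangeability. *)
Lemma ffcons_lift_perm b (g : {ffun 'I_m -> 'I_d}) (s : 'S_m) :
  ffcons b [ffun i => g (s i)] =
  [ffun i => ffcons b g (lift_perm ord0 ord0 s i)].
Proof.
apply/ffunP => i; rewrite [RHS]ffunE; have [j ->|->] := unliftP ord0 i.
  by rewrite lift_perm_lift !ffcons_lift ffunE.
by rewrite lift_perm_id !ffcons0.
Qed.

End FfunCons.

Lemma ffcons_tperm d m b c (g : {ffun 'I_m -> 'I_d}) :
  [ffun i => ffcons c (ffcons b g) (tperm ord0 (lift ord0 ord0) i)] =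
  ffcons b (ffcons c g).
Proof.
apply/ffunP => i; rewrite ffunE; have [j ->|->] := unliftP ord0 i; last first.
  by rewrite tpermL ffcons_lift !ffcons0.
have [j' ->|->] := unliftP ord0 j; last first.
  by rewrite tpermR ffcons_lift !ffcons0.
by rewrite tpermD // !ffcons_lift.
Qed.

Section DeFinetti.
Context {R : realType} (p d : nat).
Local Notation C := R[i].

(* Operators on C^p (x) (C^d)^(x)m, as kernels on the computational basis. *)
Definition extension m :=
  ('I_p * {ffun 'I_m -> 'I_d})%type -> ('I_p * {ffun 'I_m -> 'I_d})%type -> C.

Definition exchangeable m (K : extension m) : Prop :=
  forall (s : 'S_m) a (f : {ffun 'I_m -> 'I_d}) a' (f' : {ffun 'I_m -> 'I_d}),
    K (a, [ffun i => f (s i)]) (a', [ffun i => f' (s i)]) = K (a, f) (a', f').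

Definition marginalA m (K : extension m) : 'M[C]_p :=
  \matrix_(a, a') \sum_f K (a, f) (a', f).

Definition mass m (K : extension m) : R := complex.Re (\tr (marginalA K)).

Definition marginal1 m (K : extension m.+1) : 'M[C]_(p * d) :=
  \matrix_(x, y) \sum_g
    K ((mxtens_unindex x).1, ffcons (mxtens_unindex x).2 g)
      ((mxtens_unindex y).1, ffcons (mxtens_unindex y).2 g).

Definition marginalB m (K : extension m.+1) : 'M[C]_d :=
  \matrix_(b, b') \sum_a \sum_g K (a, ffcons b g) (a, ffcons b' g).

(* The unnormalized state after outcome [x] on the first site. *)
Definition conditioned m (x : povm_index d) (K : extension m.+1) :
    extension m :=
  fun u v => measure_kernel x
    (fun b b' => K (u.1, ffcons b u.2) (v.1, ffcons b' v.2)).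

(** Mass times the purity of the normalized operator, as [frob2 A = tr(A^2)] for Hermitian [A]; it
    is [0] when the mass is. *)
Definition energy m (K : extension m) : R := frob2 (marginalA K) / mass K.

Lemma marginal1E m (K : extension m.+1) a b a' b' :
  marginal1 K (mxtens_index (a, b)) (mxtens_index (a', b')) =
  \sum_g K (a, ffcons b g) (a', ffcons b' g).
Proof. by rewrite mxE !mxtens_indexK. Qed.

Lemma gram_conditioned m x (K : extension m.+1) :
  gram K -> gram (conditioned x K).
Proof.
move=> gK; exact: (gram_contract (fun (u : 'I_p * {ffun 'I_m -> 'I_d}) b =>
  (u.1, ffcons b u.2)) gK (gram_effect x)).
Qed.

Lemma exchangeable_conditioned m x (K : extension m.+1) :
  exchangeable K -> exchangeable (conditioned x K).
Proof.
move=> eK s a f a' f'; rewrite /conditioned /measure_kernel /=.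
apply: eq_bigr => b _; apply: eq_bigr => b' _.
by rewrite !ffcons_lift_perm eK.
Qed.

Lemma measure_kernel_bigsum (I : finType) x (Z : I -> 'I_d -> 'I_d -> C) :
  measure_kernel x (fun b b' => \sum_i Z i b b') =
  \sum_i measure_kernel x (Z i).
Proof.
rewrite /measure_kernel [RHS]exchange_big; apply: eq_bigr => b _.
rewrite [RHS]exchange_big; apply: eq_bigr => b' _.
by rewrite mulr_sumr.
Qed.

Lemma marginalA_conditioned m x (K : extension m.+1) a a' :
  marginalA (conditioned x K) a a' = measure_kernel x
    (fun b b' => \sum_g K (a, ffcons b g) (a', ffcons b' g)).
Proof. by rewrite mxE measure_kernel_bigsum. Qed.

Lemma sum_marginalA_conditioned m (K : extension m.+1) :
  \sum_x marginalA (conditioned x K) = marginalA K.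
Proof.
apply/matrixP => a a'; rewrite summxE.
rewrite (eq_bigr _ (fun x _ => marginalA_conditioned x K a a')).
by rewrite measure_kernel_sum mxE sum_ffcons.
Qed.

Lemma sum_mass_conditioned m (K : extension m.+1) :
  \sum_x mass (conditioned x K) = mass K.
Proof.
by rewrite /mass -sum_marginalA_conditioned
  (raddf_sum (@mxtrace C p)) Re_sum.
Qed.

(** Measuring the first site and forgetting the outcome leaves the marginal on the second site,
    which the transposition of the two sites carries to the first. *)
Lemma sum_marginal1_conditioned m (K : extension m.+2) : exchangeable K ->
  \sum_x marginal1 (conditioned x K) = marginal1 K.
Proof.
move=> eK; apply: eq_tensmx => -[a b] [a' b'].
rewrite summxE (eq_bigr _ (fun x _ => marginal1E (conditioned x K) a b a' b')).
rewrite marginal1E sum_ffcons exchange_big [RHS]exchange_big.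
apply: eq_bigr => g _; rewrite measure_kernel_sum; apply: eq_bigr => c _ /=.
rewrite -(eK (tperm ord0 (lift ord0 ord0)) a (ffcons c (ffcons b g)) a').
by rewrite !ffcons_tperm.
Qed.

(** Informational completeness: the joint operator is linear in the conditional ones. If these
    hardly depend on the outcome up to their weights, the joint operator is nearly a product. *)
Lemma marginal1_frame m (K : extension m.+1) :
  marginal1 K = \sum_x marginalA (conditioned x K) *t dual_frame x.
Proof.
apply: eq_tensmx => -[a b] [a' b']; rewrite summxE marginal1E.
rewrite -(measure_kernel_frame
  (fun b b' => \sum_g K (a, ffcons b g) (a', ffcons b' g))).
by apply: eq_bigr => x _; rewrite tensmxE marginalA_conditioned.
Qed.

Lemma marginalB_frame m (K : extension m.+1) :
  marginalB K = \sum_x \tr (marginalA (conditioned x K)) *: dual_frame x.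
Proof.
apply/matrixP => b b'; rewrite mxE summxE.
rewrite -(measure_kernel_frame
  (fun b b' => \sum_a \sum_g K (a, ffcons b g) (a, ffcons b' g))).
apply: eq_bigr => x _; rewrite [RHS]mxE; congr (_ * _).
rewrite (measure_kernel_bigsum x
  (fun a b b' => \sum_g K (a, ffcons b g) (a, ffcons b' g))).
by apply: eq_bigr => a _; rewrite marginalA_conditioned.
Qed.

Lemma psd_marginalA m (K : extension m) : gram K -> psd (marginalA K).
Proof.
move=> gK; apply: gram_psd.
have := gram_ptrace (fun a (f : {ffun 'I_m -> 'I_d}) => (a, f) : 'I_p * _) gK.
by apply: eq_gram => a a'; rewrite mxE.
Qed.

Lemma psd_marginalB m (K : extension m.+1) : gram K -> psd (marginalB K).
Proof.
move=> gK; apply: gram_psd.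
have := gram_ptrace (fun b (ag : 'I_p * {ffun 'I_m -> 'I_d}) =>
  (ag.1, ffcons b ag.2)) gK.
by apply: eq_gram => b b'; rewrite mxE pair_bigA.
Qed.

Lemma psd_trace_ge0 n (M : 'M[C]_n) : psd M -> 0 <= \tr M.
Proof.
by move=> /psd_gram gM; apply: sumr_ge0 => i _; exact: gram_diag_ge0 gM.
Qed.

(** The minors of order two give [|M_ij|^2 <= M_ii M_jj]; sum over [i] and [j]. *)
Lemma psd_frob2_le n (M : 'M[C]_n) :
  psd M -> frob2 M <= complex.Re (\tr M) ^+ 2.
Proof.
move=> /psd_gram gM; rewrite expr2 /mxtrace Re_sum mulr_suml.
apply: ler_sum => i _; rewrite mulr_sumr; apply: ler_sum => j _.
exact: (gram_minor i j gM).
Qed.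

Lemma mass_ge0 m (K : extension m) : gram K -> 0 <= mass K.
Proof. by move=> /psd_marginalA /psd_trace_ge0 /Re_nneg. Qed.

Lemma mass_real m (K : extension m) : gram K -> \tr (marginalA K) = (mass K)%:C%C.
Proof. by move=> /psd_marginalA /psd_trace_ge0 /complex_nneg. Qed.

Lemma mass0_marginalA m (K : extension m) :
  gram K -> mass K = 0 -> marginalA K = 0.
Proof.
move=> gK K0; apply/matrixP => a a'; rewrite [RHS]mxE.
apply: ComplexField.Normc.eq0_normc; apply/eqP.
rewrite -sqrf_eq0 eq_le sqr_ge0 andbT.
apply: le_trans (entry_le_frob2 _ _ _) _.
apply: le_trans (psd_frob2_le (psd_marginalA gK)) _.
by rewrite -/(mass K) K0 expr0n.
Qed.

Lemma energy_le_mass m (K : extension m) : gram K -> energy K <= mass K.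
Proof.
move=> gK; have [K0|K0] := eqVneq (mass K) 0.
  by rewrite /energy K0 invr0 mulr0.
rewrite ler_pdivrMr ?lt_neqAle ?mass_ge0 // 1?eq_sym ?K0 // -expr2.
exact: psd_frob2_le (psd_marginalA gK).
Qed.

(** For positive [K] both marginals have trace [mass K], hence one division. *)
Definition product_state m (K : extension m.+1) : 'M[C]_(p * d) :=
  (mass K)^-1%:C%C *: (marginalA K *t marginalB K).

Lemma separable_product_state m (K : extension m.+1) :
  gram K -> separable (product_state K).
Proof.
move=> gK; rewrite /product_state -tensmxZl.
have iK : 0 <= (mass K)^-1%:C%C :> C by rewrite ler0c invr_ge0 mass_ge0.
exists 1, (fun _ => (mass K)^-1%:C%C *: marginalA K), (fun _ => marginalB K).
split=> [_|_|]; last by rewrite big_ord1.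
  apply: gram_psd; have /psd_gram/(gramZ iK) := psd_marginalA gK.
  by apply: eq_gram => a a'; rewrite [RHS]mxE.
exact: psd_marginalB.
Qed.

(** The square of the norm of a dual frame element, times the factor [p^2] from
    [l1norm^2 <= p^2 * frob2]. *)
Definition definetti_const : R := (2 * d ^ 2)%:R ^+ 2 * (p * p)%:R.

(* Measuring one site changes the conditional state of A by the energy
   increment only, hence A is nearly independent of that site. *)
Lemma marginal1_product_state m (K : extension m.+1) : gram K ->
  l1norm (marginal1 K - product_state K) ^+ 2 <=
  definetti_const * (mass K * (\sum_x energy (conditioned x K) - energy K)).
Proof.
move=> gK; have gx x := gram_conditioned x gK.
pose A x := marginalA (conditioned x K); pose t x := mass (conditioned x K).
have At0 x : t x = 0 -> A x = 0 by exact: mass0_marginalA.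
have t0 x : 0 <= t x by exact: mass_ge0.
have TE : \sum_x t x = mass K by exact: sum_mass_conditioned.
have AE : \sum_x A x = marginalA K by exact: sum_marginalA_conditioned.
(* The deviation from what a site independent of [A] would give. The coefficients of [marginalB K]
   in the dual frame are the [t x], so [marginal1 K - product_state K] expands with coefficients
   [Y x]. *)
pose Y x := A x - (t x / mass K)%:C%C *: marginalA K.
have -> : marginal1 K - product_state K = \sum_x Y x *t dual_frame x.
  rewrite marginal1_frame /product_state marginalB_frame tensmx_sumr scaler_sumr.
  rewrite -sumrB; apply: eq_bigr => x _.
  rewrite mass_real // tensmxZr scalerA -rmorphM /= mulrC.
  apply/matrixP => i j; rewrite !mxE; ring.
have YE : l1norm (\sum_x Y x *t dual_frame x) <=
    (2 * d ^ 2)%:R * \sum_x l1norm (Y x).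
  apply: le_trans (l1norm_sum _) _; rewrite mulr_sumr; apply: ler_sum => x _.
  by rewrite l1norm_tens l1norm_dual_frame mulrC.
have Y0 : 0 <= \sum_x l1norm (Y x) by apply: sumr_ge0 => x _; exact: l1norm_ge0.
apply: le_trans (_ : ((2 * d ^ 2)%:R * \sum_x l1norm (Y x)) ^+ 2 <= _).
  by rewrite ler_sqr ?nnegrE ?mulr_ge0 ?ler0n ?l1norm_ge0.
rewrite exprMn /definetti_const -[leRHS]mulrA ler_wpM2l ?sqr_ge0 //.
have := @frob2_variance R _ p t A At0; rewrite TE AE => vE.
(* Cauchy-Schwarz with weights [t x]; where a weight vanishes, so does [Y x]. *)
apply: le_trans (_ : (\sum_x t x) * (\sum_x l1norm (Y x) ^+ 2 / t x) <= _).
  apply: sum_sqr_le => x; [exact: l1norm_ge0|exact: t0| |].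
    by rewrite mulr_ge0 ?invr_ge0 ?sqr_ge0.
  have [tx|tx] := eqVneq (t x) 0; last by rewrite mulrC divfK.
  have -> : Y x = 0 by rewrite /Y At0 // tx mul0r scale0r subr0.
  have -> : l1norm (0 : 'M[C]_p) = 0.
    by rewrite /l1norm !big1 // => i _; rewrite big1 // => j _;
      rewrite mxE ComplexField.Normc.normc0.
  by rewrite expr0n /= mul0r mulr0.
rewrite TE mulrCA ler_wpM2l ?mass_ge0 //.
rewrite -[X in _ * X]/(\sum_x frob2 (A x) / t x - frob2 (marginalA K) / mass K).
rewrite -vE mulr_sumr; apply: ler_sum => x _.
by rewrite mulrA ler_wpM2r ?invr_ge0 // l1norm_le_frob2.
Qed.

(** The gap [mass K - energy K] splits into the energy gained by measuring the first site, which
    bounds the error of [product_state K], and the mean remaining gap, which bounds [m] times the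
    squared error of the sum of the inductive approximants. The better of the two candidates obeys
    both bounds, whose sum raises the factor to [m + 1]. *)
Theorem definetti m (K : extension m.+1) : gram K -> exchangeable K ->
  exists N, separable N /\
    m%:R * l1norm (marginal1 K - N) ^+ 2 <=
    definetti_const * (mass K * (mass K - energy K)).
Proof.
have c0 : 0 <= definetti_const by rewrite mulr_ge0 ?sqr_ge0 ?ler0n.
elim: m K => [|m IHm] K gK eK.
  exists (product_state K); split; first exact: separable_product_state.
  by rewrite mul0r !mulr_ge0 ?mass_ge0 ?subr_ge0 ?energy_le_mass.
have gx x := gram_conditioned x gK.
have /choice[N NP] x := IHm _ (gx x) (exchangeable_conditioned x eK).
have sepN : separable (\sum_x N x) by apply: separable_sum => x; exact: (NP x).1.
have hN : m%:R * l1norm (marginal1 K - \sum_x N x) ^+ 2 <=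
    definetti_const * (mass K * (mass K - \sum_x energy (conditioned x K))).
  rewrite -sum_marginal1_conditioned // -sumrB.
  set D := fun x => l1norm (marginal1 (conditioned x K) - N x).
  have sm : Num.sqrt m%:R ^+ 2 = m%:R :> R by rewrite sqr_sqrtr ?ler0n.
  (* Cauchy-Schwarz over the outcomes: each inductive bound has the form [d^2 <= t e], with [t] the
     mass and [e] a multiple of the gap. *)
  apply: le_trans (_ : (\sum_x Num.sqrt m%:R * D x) ^+ 2 <= _).
    rewrite -mulr_sumr exprMn sm ler_wpM2l ?ler0n // ler_sqr ?nnegrE ?l1norm_ge0 //.
      exact: l1norm_sum.
    by apply: sumr_ge0 => x _; exact: l1norm_ge0.
  rewrite -[in X in _ <= X]sum_mass_conditioned -sumrB mulrCA mulr_sumr.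
  apply: sum_sqr_le => x; rewrite ?mulr_ge0 ?sqrtr_ge0 ?l1norm_ge0 ?mass_ge0 //.
    by rewrite subr_ge0 energy_le_mass.
  by rewrite exprMn sm [leRHS]mulrCA; exact: (NP x).2.
have hP := marginal1_product_state gK.
have sepP := separable_product_state gK.
set E1 := \sum_x energy _ in hN hP.
set D1 := l1norm (_ - product_state K) in hP.
set D2 := l1norm (_ - \sum_x N x) in hN.
have D10 : 0 <= D1 by exact: l1norm_ge0.
have D20 : 0 <= D2 by exact: l1norm_ge0.
have sumE : definetti_const * (mass K * (mass K - energy K)) =
  definetti_const * (mass K * (mass K - E1)) +
  definetti_const * (mass K * (E1 - energy K)) by ring.
have [D12|/ltW D21] := leP D1 D2.
  exists (product_state K); split => //; rewrite sumE -natr1 mulrDl mul1r.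
  apply: lerD hP; apply: le_trans hN; rewrite ler_wpM2l ?ler0n //.
  by rewrite ler_sqr.
exists (\sum_x N x); split => //; rewrite sumE -natr1 mulrDl mul1r.
by apply: lerD hN _; apply: le_trans hP; rewrite ler_sqr.
Qed.

End DeFinetti.

(** * Symmetric protocols *)

Section ChannelOfChoi.
Context {R : realType}.
Local Notation C := R[i].

Definition channel_of p q (M : 'M[C]_(p * q)) (rho : 'M[C]_p) : 'M[C]_q :=
  \sum_i \sum_j rho i j *: tblock M i j.

Lemma channel_of_linear p q (M : 'M[C]_(p * q)) : linear (channel_of M).
Proof.
move=> a u v; rewrite /channel_of scaler_sumr -big_split; apply: eq_bigr => i _.
rewrite /= scaler_sumr -big_split; apply: eq_bigr => j _ /=.
by rewrite !mxE scalerDl scalerA.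
Qed.

Lemma channel_ofE p q (M : 'M[C]_(p * q)) rho b b' :
  channel_of M rho b b' = \sum_i \sum_j rho i j *
    M (mxtens_index (i, b)) (mxtens_index (j, b')).
Proof.
rewrite summxE; apply: eq_bigr => i _; rewrite summxE.
by apply: eq_bigr => j _; rewrite !mxE.
Qed.

Lemma choi_channel_of p q (M : 'M[C]_(p * q)) : choi (channel_of M) = M.
Proof.
apply: eq_tensmx => -[i b] [j b']; rewrite choiE channel_ofE.
rewrite (bigD1 i) //= (bigD1 j) //= mxE !eqxx mul1r.
rewrite !big1 ?addr0 // => [k|k] /negbTE ki.
  by rewrite big1 // => l _; rewrite mxE ki mul0r.
by rewrite mxE ki andbF mul0r.
Qed.

Lemma choi_inj p q (S S' : 'M[C]_p -> 'M[C]_q) :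
  linear S -> linear S' -> choi S = choi S' -> S = S'.
Proof.
move=> linS linS' SS'; apply/funext => rho; apply/matrixP => b b'.
by rewrite (linear_choiE linS) (linear_choiE linS') SS'.
Qed.

Lemma linear_sumZ p q (S : 'M[C]_p -> 'M[C]_q) (linS : linear S)
    (I : finType) (c : I -> C) (M : I -> 'M[C]_p) :
  S (\sum_k c k *: M k) = \sum_k c k *: S (M k).
Proof.
pose S' : {linear 'M[C]_p -> 'M[C]_q} := HB.pack S
  (GRing.isLinear.Build _ _ _ _ S linS).
rewrite -[S]/(S' : _ -> _) linear_sum.
by apply: eq_bigr => k _; rewrite linearZ.
Qed.

Lemma separable_psd p q (M : 'M[C]_(p * q)) : separable M -> psd M.
Proof.
move=> [n [P [Q [pP pQ ->]]]]; apply/psd_tensP.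
have gPQ k := gram_tens (psd_gram (pP k)) (psd_gram (pQ k)).
apply: eq_gram (gram_sum gPQ) => -[i b] [j b'] /=.
by rewrite summxE; apply: eq_bigr => k _; rewrite tensmxE.
Qed.

Lemma mxtrace_delta n (i j : 'I_n) : \tr (delta_mx i j : 'M[C]_n) = (i == j)%:R.
Proof.
rewrite /mxtrace (bigD1 i) //= mxE eqxx big1 ?addr0 // => k /negbTE ki.
by rewrite mxE ki.
Qed.

(** In this form trace preservation is a condition on entries of the Choi matrix, which passes to
    limits. *)
Lemma trace_preservingP p q (S : 'M[C]_p -> 'M[C]_q) (linS : linear S) :
  (forall M, \tr (S M) = \tr M) <->
  (forall i j, \sum_b choi S (mxtens_index (i, b)) (mxtens_index (j, b)) =
    (i == j)%:R).
Proof.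
split=> [trS i j|trS M].
  rewrite -mxtrace_delta -trS.
  by apply: eq_bigr => b _; rewrite choiE.
transitivity (\sum_i \sum_j M i j * (i == j)%:R).
  rewrite /mxtrace (eq_bigr _ (fun b _ => linear_choiE linS M b b)).
  rewrite exchange_big; apply: eq_bigr => i _; rewrite exchange_big.
  by apply: eq_bigr => j _; rewrite -trS mulr_sumr.
apply: eq_bigr => i _; rewrite (bigD1 i) //= eqxx mulr1 big1 ?addr0 //.
by move=> j /negbTE; rewrite eq_sym => ->; rewrite mulr0.
Qed.

End ChannelOfChoi.

Section Protocol.
Context {R : realType}.
Local Notation C := R[i].

Lemma gram_conj (I : finType) (K : I -> I -> C) i j :
  gram K -> K j i = (K i j)^*.
Proof.
move=> [J [V KV]]; rewrite !KV rmorph_sum; apply: eq_bigr => k _.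
by rewrite rmorphM /= conjCK mulrC.
Qed.

(** [perm_op s] moves basis vectors by [s^-1], hence coordinates by [s]. *)
Definition permute d m (s : 'S_m) (x : 'I_(tpow d m)) : 'I_(tpow d m) :=
  let f : {ffun 'I_m -> 'I_d} := enum_val x in enum_rank [ffun i => f (s i)].

Lemma perm_opE d m (s : 'S_m) x y :
  perm_op d s x y = (y == permute s x)%:R :> C.
Proof.
rewrite mxE; congr (_ : bool)%:R; apply/eqP/eqP => [xy|->].
  apply: (canRL enum_valK); apply/ffunP => i.
  by rewrite ffunE xy ffunE permK.
by rewrite /permute enum_rankK; apply/ffunP => i; rewrite !ffunE permKV.
Qed.

Lemma mul_perm_op d m n (s : 'S_m) (W : 'M[C]_(tpow d m, n)) x y :
  (perm_op d s *m W) x y = W (permute s x) y.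
Proof.
rewrite mxE (bigD1 (permute s x)) //= perm_opE eqxx mul1r big1 ?addr0 //.
by move=> z /negbTE zx; rewrite perm_opE zx mul0r.
Qed.

Lemma conj_perm_op p d m (s : 'S_m) (W : 'M[C]_(p * tpow d m)) a x a' y :
  let U := 1%:M *t perm_op d s in
  (U *m W *m U^t*) (mxtens_index (a, x)) (mxtens_index (a', y)) =
  W (mxtens_index (a, permute s x)) (mxtens_index (a', permute s y)).
Proof.
move=> U; have UE b z c t : U (mxtens_index (b, z)) (mxtens_index (c, t)) =
    ((mxtens_index (c, t)) == mxtens_index (b, permute s z))%:R.
  rewrite tensmxE mxE perm_opE -natrM mulnb (can_eq (@mxtens_indexK _ _)).
  by rewrite xpair_eqE eq_sym.
have Ul k z : (U *m W) (mxtens_index z) k =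
    W (mxtens_index (z.1, permute s z.2)) k.
  case: z => b z; rewrite mxE (bigD1 (mxtens_index (b, permute s z))) //=.
  rewrite UE eqxx mul1r big1 ?addr0 // => l.
  by case: (mxtens_indexP l) => c t /negbTE ct; rewrite UE ct mul0r.
have Uc k l : U^t* k l = (U l k)^* by rewrite mxE [U^T _ _]mxE.
rewrite mxE (bigD1 (mxtens_index (a', permute s y))) //= Ul /=.
rewrite Uc UE eqxx conjC1 mulr1 big1 ?addr0 // => l.
case: (mxtens_indexP l) => c t /negbTE ct.
by rewrite Uc UE ct conjC0 mulr0.
Qed.

Lemma permuteP d m (s : 'S_m) (f : {ffun 'I_m -> 'I_d}) :
  permute s (enum_rank f) = enum_rank [ffun i => f (s i)].
Proof. by rewrite /permute enum_rankK. Qed.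

(** Polarization. It extends the bosonic condition, which concerns density operators only, to all
    operators by linearity. *)
Lemma delta_ketbra p (i j : 'I_p) : delta_mx i j =
  \sum_(k < 4) (4^-1 * 'i ^+ k) *:
    ketbra (delta_mx i 0 + 'i ^+ k *: delta_mx j 0) :> 'M[C]_p.
Proof.
apply/matrixP => a b; rewrite summxE.
rewrite (eq_bigr (fun k : 'I_4 => 4^-1 * 'i ^+ k *
   (((a == i)%:R + 'i ^+ k * (a == j)%:R) *
    ((b == i)%:R + ('i ^+ k)^* * (b == j)%:R)))); last first.
  move=> k _; rewrite mxE ketbraE !mxE !andbT.
  by rewrite rmorphD rmorphM /= !conjC_nat.
rewrite !big_ord_recl big_ord0 addr0 /= !mxE -mulnb natrM !rmorphXn /= conjCi.
have i2 : 'i * 'i = -1 :> C by rewrite -expr2 sqrCi.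
have -> : bump 0 0 = 1 by []. have -> : bump 0 (bump 0 0) = 2 by [].
have -> : bump 0 (bump 0 (bump 0 0)) = 3 by [].
have -> : (- 'i) ^+ 2 = -1 :> C by rewrite sqrrN sqrCi.
have -> : (- 'i) ^+ 3 = 'i :> C by rewrite exprS sqrrN sqrCi mulrN1 opprK.
have -> : 'i ^+ 3 = - 'i :> C by rewrite exprS sqrCi mulrN1.
rewrite !expr0 !expr1 sqrCi.
set x := (a == i)%:R; set y := (a == j)%:R; set u := (b == i)%:R;
  set v := (b == j)%:R.
transitivity (4^-1 * ((2 - 2 * ('i * 'i)) * (x * v) +
                      (2 + 2 * ('i * 'i)) * (y * u))).
  by rewrite i2; field.
ring.
Qed.

Lemma bosonic_permute p d m (T : 'M[C]_p -> 'M[C]_(tpow d m)) (s : 'S_m) M x y :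
  linear T -> bosonic T -> T M (permute s x) y = T M x y.
Proof.
move=> linT bT; rewrite -mul_perm_op.
suff kT v : perm_op d s *m T (ketbra v) = T (ketbra v).
  have dT i j : perm_op d s *m T (delta_mx i j) = T (delta_mx i j).
    rewrite delta_ketbra (linear_sumZ linT) mulmx_sumr; apply: eq_bigr => k _.
    by rewrite -scalemxAr kT.
  congr (fun_of_matrix _ x y); rewrite (linear_expand linT).
  rewrite mulmx_sumr; apply: eq_bigr => i _.
  by rewrite mulmx_sumr; apply: eq_bigr => j _; rewrite -scalemxAr dT.
have T0 : T 0 = 0.
  have := linear_sumZ linT (fun _ : 'I_0 => 0) (fun _ => 0).
  by rewrite !big_ord0.
have TZ a N : T (a *: N) = a *: T N.
  have := linear_sumZ linT (fun _ : 'I_1 => a) (fun _ => N).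
  by rewrite !big_ord1.
have [v0|v0] := eqVneq (frob2 v) 0.
  suff -> : ketbra v = 0 by rewrite T0 mulmx0.
  apply/matrixP => i j; rewrite ketbraE mxE.
  suff -> : v i 0 = 0 by rewrite mul0r.
  apply: ComplexField.Normc.eq0_normc; apply/eqP.
  by rewrite -sqrf_eq0 eq_le sqr_ge0 andbT -v0 entry_le_frob2.
have nv : (frob2 v)%:C%C != 0 :> C.
  by apply: contra v0 => /eqP/complexI ->.
have dv : density ((frob2 v)%:C%C^-1 *: ketbra v).
  split; last by rewrite mxtraceZ mxtrace_ketbra mulVf.
  apply: gram_psd; apply: eq_gram (gramZ (_ : 0 <= (frob2 v)%:C%C^-1)
    (psd_gram (ketbra_psd v))) => [i j|]; first by rewrite [RHS]mxE.
  by rewrite invr_ge0 ler0c frob2_ge0.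
(* Symmetry of every vector in the range, tested on basis vectors, is an identity of matrices. *)
have := fun u => bT _ dv u s; rewrite TZ => h.
have {h} : perm_op d s *m ((frob2 v)%:C%C^-1 *: T (ketbra v)) =
    (frob2 v)%:C%C^-1 *: T (ketbra v).
  apply/matrixP => a b.
  have /matrixP/(_ a 0) := h (delta_mx b 0).
  by rewrite mulmxA -!colE !mxE.
rewrite -scalemxAr => /(congr1 (fun M => (frob2 v)%:C%C *: M)).
by rewrite !scalerA divff // !scale1r.
Qed.

Definition protocol_kernel p d m (T : 'M[C]_p -> 'M[C]_(tpow d m)) :
    extension p d m :=
  fun u v => T (delta_mx u.1 v.1) (enum_rank u.2) (enum_rank v.2).

Lemma gram_protocol_kernel p d m (T : 'M[C]_p -> 'M[C]_(tpow d m)) :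
  channel T -> gram (protocol_kernel T).
Proof.
move=> [_ cpT _]; have /psd_tensP := cp_choi_psd cpT.
move=> /(gram_comp (fun u : 'I_p * {ffun 'I_m -> 'I_d} => (u.1, enum_rank u.2))).
by apply: eq_gram => u v; rewrite choiE.
Qed.

(** In the bosonic class a permutation may act on the rows alone; Hermitian symmetry carries this to
    the columns, and together they give the two-sided invariance of the other class. *)
Lemma exchangeable_protocol_kernel c p d m
    (T : 'M[C]_p -> 'M[C]_(tpow d m)) :
  symmetric_protocol c T -> exchangeable (protocol_kernel T).
Proof.
move=> [chT symT] s a f a' f'; rewrite /protocol_kernel /= -!permuteP.
case: c symT => [exT|boT].
  rewrite -!choiE; have /= := exT s => /matrixP.
  move=> /(_ (mxtens_index (a, enum_rank f)) (mxtens_index (a', enum_rank f'))).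
  by rewrite conj_perm_op.
have gK := gram_protocol_kernel chT.
have [linT _ _] := chT; rewrite bosonic_permute // permuteP.
have := gram_conj (a', [ffun i => f' (s i)]) (a, f) gK.
rewrite /protocol_kernel /= => ->; rewrite -permuteP bosonic_permute //.
by have := gram_conj (a', f') (a, f) gK; rewrite /protocol_kernel /= => ->.
Qed.

Lemma ptrace_rest_linear p d m (T : 'M[C]_p -> 'M[C]_(tpow d m.+1)) :
  linear T -> linear (fun rho => ptrace_rest (T rho)).
Proof.
move=> linT a u v; apply/matrixP => b b'; rewrite linT !mxE mulr_sumr.
by rewrite -big_split; apply: eq_bigr => g _; rewrite !mxE.
Qed.

Lemma ampl_ptrace_rest p d m (T : 'M[C]_p -> 'M[C]_(tpow d m.+1)) :
  ampl (@ptrace_rest R d m) (choi T) = choi (fun rho => ptrace_rest (T rho)).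
Proof. by apply: eq_bigr => i _; apply: eq_bigr => j _; rewrite tblock_choi. Qed.

Lemma marginal1_protocol_kernel p d m (T : 'M[C]_p -> 'M[C]_(tpow d m.+1)) :
  marginal1 (protocol_kernel T) = choi (fun rho => ptrace_rest (T rho)).
Proof.
apply: eq_tensmx => -[a b] [a' b']; rewrite marginal1E choiE mxE.
by [].
Qed.

Lemma sum_tpow (V : nmodType) d m (F : 'I_(tpow d m) -> V) :
  \sum_x F x = \sum_(f : {ffun 'I_m -> 'I_d}) F (enum_rank f).
Proof. by rewrite (reindex _ (onW_bij _ (@enum_rank_bij _))). Qed.

Lemma mxtrace_ptrace_rest d m (M : 'M[C]_(tpow d m.+1)) :
  \tr (ptrace_rest M) = \tr M.
Proof.
rewrite /mxtrace sum_tpow sum_ffcons; apply: eq_bigr => b _.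
by rewrite mxE.
Qed.

Lemma channel_ptrace_rest p d m (T : 'M[C]_p -> 'M[C]_(tpow d m.+1)) :
  channel T -> channel (fun rho => ptrace_rest (T rho)).
Proof.
move=> chT; have [linT cpT trT] := chT.
have linS := ptrace_rest_linear linT; split=> //.
  apply: choi_psd_cp => //; apply/psd_tensP.
  have := gram_ptrace (fun (u : 'I_p * 'I_d) (g : {ffun 'I_m -> 'I_d}) =>
    (u.1, ffcons u.2 g)) (gram_protocol_kernel chT).
  by apply: eq_gram => -[a b] [a' b'] /=; rewrite choiE mxE.
by move=> M; rewrite mxtrace_ptrace_rest trT.
Qed.

Lemma mass_protocol_kernel p d m (T : 'M[C]_p -> 'M[C]_(tpow d m)) :
  channel T -> mass (protocol_kernel T) = p%:R.
Proof.
move=> [_ _ trT]; rewrite /mass.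
have -> : \tr (marginalA (protocol_kernel T)) = p%:R.
  rewrite /mxtrace -[in RHS](card_ord p) -sumr_const.
  apply: eq_bigr => a _; rewrite mxE.
  have := trT (delta_mx a a); rewrite mxtrace_delta eqxx => trTa.
  by apply: etrans trTa; rewrite /mxtrace sum_tpow.
by rewrite -(rmorph_nat (real_complex R)).
Qed.

(** The mass of a Choi matrix is [p] and the energy is nonnegative, so the available potential is
    bounded independently of [m]. *)
Theorem protocol_near_separable c p d m (T : 'M[C]_p -> 'M[C]_(tpow d m.+1)) :
  symmetric_protocol c T -> exists N, separable N /\
  m%:R * l1norm (choi (fun rho => ptrace_rest (T rho)) - N) ^+ 2 <=
  definetti_const (R:=R) p d * p%:R ^+ 2.
Proof.
move=> symT; have [chT _] := symT; have gK := gram_protocol_kernel chT.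
have [N [sepN leN]] := definetti gK (exchangeable_protocol_kernel symT).
exists N; split=> //; rewrite -marginal1_protocol_kernel.
apply: le_trans leN _; rewrite mass_protocol_kernel // ler_wpM2l //.
  by rewrite mulr_ge0 ?sqr_ge0 ?ler0n.
rewrite expr2 ler_wpM2l ?ler0n // gerBl.
by rewrite mulr_ge0 ?frob2_ge0 // invr_ge0 mass_ge0.
Qed.

End Protocol.

(** * Measure-and-prepare protocols and risks *)

Section Cloning.
Context {R : realType}.
Local Notation C := R[i].

(** The product vector of [m] copies of [w]. It is totally symmetric, which puts the protocol built
    from it in both classes. *)
Definition tpow_vec d m (w : 'cV[C]_d) : 'cV[C]_(tpow d m) :=
  \col_x let f : {ffun 'I_m -> 'I_d} := enum_val x in \prod_i w (f i) 0.

Lemma tpow_vecE d m (w : 'cV[C]_d) (f : {ffun 'I_m -> 'I_d}) :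
  tpow_vec m w (enum_rank f) 0 = \prod_i w (f i) 0.
Proof. by rewrite mxE enum_rankK. Qed.

Lemma tpow_vec_permute d m (w : 'cV[C]_d) (s : 'S_m) x :
  tpow_vec m w (permute s x) 0 = tpow_vec m w x 0.
Proof.
rewrite tpow_vecE mxE [RHS](reindex_perm s) /=.
by apply: eq_bigr => i _; rewrite ffunE.
Qed.

Lemma tpow_vec_cons d m (w : 'cV[C]_d) b (g : {ffun 'I_m -> 'I_d}) :
  tpow_vec m.+1 w (enum_rank (ffcons b g)) 0 = w b 0 * \prod_i w (g i) 0.
Proof.
rewrite tpow_vecE big_ord_recl ffcons0; congr (_ * _).
by apply: eq_bigr => i _; rewrite ffcons_lift.
Qed.

Lemma tpow_vec_norm d m (w : 'cV[C]_d) :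
  \sum_(g : {ffun 'I_m -> 'I_d})
    (\prod_i w (g i) 0) * (\prod_i w (g i) 0)^* = (frob2 w ^+ m)%:C%C.
Proof.
rewrite rmorphXn /=.
have -> : (frob2 w)%:C%C = \sum_b w b 0 * (w b 0)^*.
  rewrite /frob2 rmorph_sum; apply: eq_bigr => b _.
  by rewrite big_ord1 mul_conjC_normc.
rewrite -[in RHS](card_ord m) -prodr_const bigA_distr_bigA /=.
by apply: eq_bigr => g _; rewrite rmorph_prod -big_split.
Qed.

(* The measure-and-prepare channel with Choi matrix [sum_k v_k v_k^* (x) w_k w_k^*]
   prepares m+1 copies of [w_k] instead of one. *)
Theorem entanglement_breaking_protocol c p d m (S : 'M[C]_p -> 'M[C]_d) :
  channel S -> entanglement_breaking S ->
  exists T : 'M[C]_p -> 'M[C]_(tpow d m.+1),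
    symmetric_protocol c T /\ (fun rho => ptrace_rest (T rho)) = S.
Proof.
move=> [linS cpS trS] /separable_ketbra[n [v [w Svw]]].
(* Only [m] of the [m + 1] copies are traced out; the remaining one keeps its own norm. *)
pose a k := (frob2 (w k) ^+ m)^-1.
pose M := \sum_k (a k)%:C%C *: (ketbra (v k) *t ketbra (tpow_vec m.+1 (w k))).
have ME i x j y : M (mxtens_index (i, x)) (mxtens_index (j, y)) =
    \sum_k (a k)%:C%C * (ketbra (v k) i j *
      (tpow_vec m.+1 (w k) x 0 * (tpow_vec m.+1 (w k) y 0)^*)).
  by rewrite summxE; apply: eq_bigr => k _; rewrite mxE tensmxE !ketbraE.
have linT := channel_of_linear M.
have trT : (fun rho => ptrace_rest (channel_of M rho)) = S.
  apply: choi_inj => //; first exact: ptrace_rest_linear.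
  apply: eq_tensmx => -[i b] [j b']; rewrite choiE mxE.
  under eq_bigr do rewrite -choiE choi_channel_of ME.
  rewrite exchange_big Svw summxE; apply: eq_bigr => k _ /=.
  rewrite tensmxE (ketbraE (w k)).
  under eq_bigr do rewrite !tpow_vec_cons rmorphM /= mulrACA.
  rewrite -mulr_sumr -mulr_sumr -mulr_sumr tpow_vec_norm.
  (* If [w k = 0], the factor [a k] need not invert anything, but the remaining copy kills the
     term. *)
  have [w0|w0] := eqVneq (frob2 (w k)) 0.
    suff -> : w k b 0 = 0 by rewrite !mul0r !mulr0.
    apply: ComplexField.Normc.eq0_normc; apply/eqP.
    by rewrite -sqrf_eq0 eq_le sqr_ge0 andbT -w0 entry_le_frob2.
  rewrite mulrCA; congr (_ * _); rewrite mulrCA -rmorphM /=.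
  by rewrite mulVf ?expf_neq0 // rmorph1 mulr1.
have chT : channel (channel_of M).
  split=> // [|rho]; last by rewrite -mxtrace_ptrace_rest -trS -trT.
  apply: choi_psd_cp => //; rewrite choi_channel_of; apply: separable_psd.
  rewrite /M; under eq_bigr do rewrite -tensmxZl.
  apply: separable_fin => k; last exact: ketbra_psd.
  apply: gram_psd; apply: eq_gram (gramZ (_ : 0 <= (a k)%:C%C)
    (psd_gram (ketbra_psd (v k)))) => [i j|]; first by rewrite [RHS]mxE.
  by rewrite ler0c invr_ge0 exprn_ge0 ?frob2_ge0.
exists (channel_of M); split=> //; split=> //; case: c => [s|rho _ u s].
  rewrite choi_channel_of; apply: eq_tensmx => -[i x] [j y].
  by rewrite conj_perm_op !ME; apply: eq_bigr => k _; rewrite !tpow_vec_permute.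
apply/matrixP => x y; rewrite mul_perm_op !mxE; apply: eq_bigr => z _.
congr (_ * _); rewrite !channel_ofE; apply: eq_bigr => i _.
apply: eq_bigr => j _; rewrite !ME; congr (_ * _); apply: eq_bigr => k _.
by rewrite tpow_vec_permute.
Qed.

End Cloning.

(** * Continuity of the risks *)

Section RiskContinuity.
Context {R : realType}.
Local Notation C := R[i].

(** Integrability is not assumed, so positive and negative parts are compared separately, each at
    cost [e]; hence [e + e]. An infinite positive part of [f] forces one for [g], and an infinite
    negative part of [g] forces one for [f]. *)
Lemma integral_perturb (d : measure_display) (T : measurableType d)
    (mu : {measure set T -> \bar R})
    (D : set T) (f g : T -> R) (e : R) :
  measurable D -> mu D = 1%E -> measurable_fun D f -> measurable_fun D g ->
  0 <= e -> (forall x, D x -> `|f x - g x| <= e) ->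
  (\int[mu]_(x in D) (f x)%:E <= \int[mu]_(x in D) (g x)%:E + (e + e)%:E)%E.
Proof.
move=> mD muD mf mg e0 fg; rewrite integralE [in leRHS]integralE.
have bound (u w : T -> R) : measurable_fun D u -> measurable_fun D w ->
    (forall x, D x -> u x <= w x + e) ->
    (\int[mu]_(x in D) (EFin \o u)^\+ x <=
     \int[mu]_(x in D) (EFin \o w)^\+ x + e%:E)%E.
  move=> mu_ mw uw.
  have -> : e%:E = (\int[mu]_(x in D) (cst e%:E x))%E.
    by rewrite integral_cst // muD mule1.
  have /measurable_EFinP mwE := mw.
  have /measurable_EFinP muE := mu_.
  rewrite -ge0_integralD //=; last exact: measurable_funepos.
  apply: ge0_le_integral => //=.
  - exact: measurable_funepos.
  - by apply: emeasurable_funD; [exact: measurable_funepos|exact: measurable_cst].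
  - move=> x Dx; rewrite !funeposE /= -!EFin_max -EFinD lee_fin ge_max.
    apply/andP; split.
      by apply: le_trans (uw x Dx) _; rewrite lerD2r le_max lexx.
    by rewrite addr_ge0 // le_max lexx orbT.
have fp : (\int[mu]_(x in D) (EFin \o f)^\+ x <=
    \int[mu]_(x in D) (EFin \o g)^\+ x + e%:E)%E.
  apply: bound => // x Dx; rewrite -lerBlDl.
  exact: le_trans (ler_norm _) (fg x Dx).
have gn : (\int[mu]_(x in D) (EFin \o g)^\- x <=
    \int[mu]_(x in D) (EFin \o f)^\- x + e%:E)%E.
  have negE (h : T -> R) : ((EFin \o h)^\- = (EFin \o (fun x => - h x)%R)^\+)%E.
    by apply/funext => x; rewrite funenegE funeposE.
  rewrite !negE; apply: bound; [exact: measurableT_comp|exact: measurableT_comp|].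
  move=> x Dx /=; have := le_trans (ler_norm _) (fg x Dx); lra.
move: fp gn.
set a := (\int[mu]_(x in D) (EFin \o f)^\+ x)%E.
set b := (\int[mu]_(x in D) (EFin \o f)^\- x)%E.
set a' := (\int[mu]_(x in D) (EFin \o g)^\+ x)%E.
set b' := (\int[mu]_(x in D) (EFin \o g)^\- x)%E.
have : (0 <= a)%E by apply: integral_ge0 => x _; exact: funepos_ge0.
have : (0 <= a')%E by apply: integral_ge0 => x _; exact: funepos_ge0.
have : (0 <= b)%E by apply: integral_ge0 => x _; exact: funeneg_ge0.
have : (0 <= b')%E by apply: integral_ge0 => x _; exact: funeneg_ge0.
case: a => [a| |]; case: b => [b| |]; case: a' => [a'| |]; case: b' => [b'| |] //=.
- by rewrite -?EFinD !lee_fin => *; lra.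
- by move=> *; rewrite !addye // leey.
- by move=> *; rewrite addeNy leNye.
Qed.

Lemma risk_perturb (p d : nat) (X : set 'M[C]_p) (k : risk_kind X)
    (gamma : 'M[C]_p -> 'M[C]_d) (L : 'M[C]_d -> 'M[C]_d -> R)
    (S S' : 'M[C]_p -> 'M[C]_d) (e : R) :
  risk_measurable k gamma L -> channel S -> channel S' -> 0 <= e ->
  (forall Sigma, X Sigma ->
    `|L (gamma Sigma) (S Sigma) - L (gamma Sigma) (S' Sigma)| <= e) ->
  (risk k gamma L S <= risk k gamma L S' + (e + e)%:E)%E.
Proof.
case: k => [|pi] /= mL chS chS' e0 LSS'; last first.
  apply: integral_perturb => //; [exact: prior_measurable|exact: prior_full| |].
    exact: mL.
  exact: mL.
apply: ge_ereal_sup => _ [Sigma XS <-].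
apply: le_trans (_ : (L (gamma Sigma) (S' Sigma))%:E + (e + e)%:E <= _)%E.
  rewrite -EFinD lee_fin.
  have := le_trans (ler_norm _) (LSS' _ XS); lra.
by apply: leeD => //; apply: ereal_sup_ubound; exists Sigma.
Qed.

Lemma density_entry_le1 p (rho : 'M[C]_p) i j :
  density rho -> normc (rho i j) <= 1.
Proof.
move=> [psdr tr1]; rewrite -(@expr_le1 _ 2) ?normc_ge0 //.
apply: le_trans (entry_le_frob2 _ _ _) (le_trans (psd_frob2_le psdr) _).
by rewrite tr1 expr1n.
Qed.

(** Entries of a density operator have modulus at most 1, which makes the bound uniform in [rho]. *)
Lemma trnorm_channel_diff p d (S S' : 'M[C]_p -> 'M[C]_d) rho :
  linear S -> linear S' -> density rho ->
  trnorm (S rho - S' rho) <= d%:R * l1norm (choi S - choi S').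
Proof.
move=> linS linS' drho; apply: le_trans (trnorm_le_l1norm _) _.
rewrite ler_wpM2l ?ler0n // {2}/l1norm sum_mxtens.
rewrite exchange_big; apply: ler_sum => b _ /=.
under [leRHS]eq_bigr do rewrite sum_mxtens.
under [leRHS]eq_bigr do rewrite exchange_big /=.
rewrite [leRHS]exchange_big; apply: ler_sum => b' _ /=.
rewrite !mxE (linear_choiE linS) (linear_choiE linS') -sumrB.
apply: le_trans (normc_le_sum _) _; apply: ler_sum => i _.
rewrite -sumrB; apply: le_trans (normc_le_sum _) _; apply: ler_sum => j _.
rewrite -mulrBr ComplexField.Normc.normcM !mxE.
by rewrite ler_piMl ?normc_ge0 // density_entry_le1.
Qed.

Lemma l1norm_le_trnorm n (A : 'M[C]_n) : l1norm A <= (n * n)%:R * trnorm A.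
Proof.
rewrite /l1norm (@le_trans _ _ (\sum_(i < n) \sum_(j < n) trnorm A)) //.
  by apply: ler_sum => i _; apply: ler_sum => j _; exact: entry_le_trnorm.
by rewrite !sumr_const !card_ord -mulrnA [leRHS]mulr_natl.
Qed.

Lemma l1normB m n (A B : 'M[C]_(m, n)) : l1norm (A - B) <= l1norm A + l1norm B.
Proof.
rewrite /l1norm -big_split; apply: ler_sum => i _ /=.
rewrite -big_split; apply: ler_sum => j _ /=; rewrite !mxE.
by rewrite -[normc (B i j)]normcN; exact: complex.le_normcD.
Qed.

End RiskContinuity.

(** * The limit of optimal protocols *)

Section Limit.
Context {R : realType} (dA dB : nat).
Local Notation C := R[i].

Definition one_site p d m (T : 'M[C]_p -> 'M[C]_(tpow d m.+1)) :
    'M[C]_p -> 'M[C]_d := fun rho => ptrace_rest (T rho).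

Context (T : forall m : nat, 'M[C]_dA -> 'M[C]_(tpow dB m.+1))
  (Tstar : 'M[C]_(dA * dB))
  (T_cvg : (fun m : nat =>
    trnorm (ampl (@ptrace_rest R dB m) (choi (T m)) - Tstar)) @ \oo
    --> (0 : R)).

Lemma one_site_cvg (e : R) : 0 < e ->
  \forall m \near \oo, l1norm (choi (one_site (T m)) - Tstar) <= e.
Proof.
(* The added 1 keeps [K] positive when a dimension is 0. *)
move=> e0; set n := (dA * dB)%N; pose K : R := (n * n)%:R + 1.
have K0 : 0 < K by rewrite ltr_wpDl ?ler0n.
have : \forall m \near \oo,
    `|0 - trnorm (ampl (@ptrace_rest R dB m) (choi (T m)) - Tstar)| <= e / K.
  by move: T_cvg => /cvgrPdist_le; apply; rewrite divr_gt0.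
apply: filterS => m; rewrite sub0r normrN ger0_norm ?trnorm_ge0 // => le_eK.
rewrite -ampl_ptrace_rest; apply: le_trans (l1norm_le_trnorm _) _.
apply: le_trans (_ : K * (e / K) <= _); last by rewrite mulrC divfK // gt_eqF.
by apply: ler_pM; rewrite ?ler0n ?trnorm_ge0 // lerDl.
Qed.

Lemma one_site_limit_separable c :
  (forall m, symmetric_protocol c (T m)) -> separable Tstar.
Proof.
move=> symT; apply: separable_closed => e e0.
have h0 : 0 < e / 2 by rewrite divr_gt0.
pose B := definetti_const (R:=R) dA dB * dA%:R ^+ 2.
(* Beyond this threshold the de Finetti bound is at most [e / 2]. *)
have near_m : \forall m \near \oo, B / (e / 2) ^+ 2 <= m%:R by exact: nbhs_infty_ger.
have [m [[mT mB] m0]] := filter_ex (filterI (filterI (one_site_cvg h0) near_m)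
  (nbhs_infty_gt 0)).
have [N [sepN leN]] := protocol_near_separable (symT m).
exists N; split=> //.
have -> : N - Tstar = (choi (one_site (T m)) - Tstar) -
    (choi (one_site (T m)) - N) by rewrite opprB [RHS]addrC addrA subrK.
apply: le_trans (l1normB _ _) _; rewrite [leRHS]splitr; apply: lerD => //.
rewrite -ler_sqr ?nnegrE ?l1norm_ge0 ?(ltW h0) //.
rewrite -(@ler_pM2l _ m%:R) ?ltr0n //; apply: le_trans leN _.
by rewrite -ler_pdivrMr // exprn_gt0.
Qed.

(** Complete positivity comes from separability, as a separable Choi matrix is positive; only trace
    preservation is obtained as a limit. *)
Lemma one_site_limit_channel c :
  (forall m, symmetric_protocol c (T m)) -> channel (channel_of Tstar).
Proof.
move=> symT; have linS := channel_of_linear Tstar; split=> //.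
  apply: choi_psd_cp => //; rewrite choi_channel_of.
  by apply: separable_psd; exact: one_site_limit_separable symT.
apply/(trace_preservingP linS) => i j; rewrite choi_channel_of.
apply/eqP; rewrite -subr_eq0; apply/eqP.
apply: ComplexField.Normc.eq0_normc; apply/eqP; rewrite eq_le normc_ge0 andbT.
apply/ler_addgt0Pr => e e0; rewrite add0r.
have [m mT] := filter_ex (one_site_cvg e0).
have [linm _ trm] := channel_ptrace_rest (symT m).1.
have /(trace_preservingP linm)/(_ i j) <- := trm.
apply: le_trans mT; rewrite -sumrB; apply: le_trans (normc_le_sum _) _.
rewrite /l1norm sum_mxtens (bigD1 i) //= -[leLHS]addr0; apply: lerD; last first.
  by do 3!apply: sumr_ge0 => ? _; exact: normc_ge0.
apply: ler_sum => b _; rewrite (bigD1 (mxtens_index (j, b))) //= -[leLHS]addr0.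
apply: lerD; last by apply: sumr_ge0 => ? _; exact: normc_ge0.
by rewrite !mxE -normcN opprB.
Qed.

Lemma one_site_limit_risk c (X : set 'M[C]_dA) (k : risk_kind X)
    (gamma : 'M[C]_dA -> 'M[C]_dB) (L : 'M[C]_dB -> 'M[C]_dB -> R)
    (r : \bar R) :
  (forall Sigma, X Sigma -> density Sigma) ->
  lipschitz_loss X gamma L -> risk_measurable k gamma L ->
  (forall m, symmetric_protocol c (T m)) ->
  (forall m, (one_site_risk k gamma L (T m) <= r)%E) ->
  (risk k gamma L (channel_of Tstar) <= r)%E.
Proof.
move=> denX [L0 lipL] mL symT Tr; have chS := one_site_limit_channel symT.
have [linS _ _] := chS.
apply/lee_addgt0Pr => e e0; have h0 : 0 < e / 2 by rewrite divr_gt0.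
(* [L0] may be negative or zero, hence the absolute value and the added 1. *)
pose K : R := `|L0| * dB%:R + 1.
have K0 : 0 < K by rewrite ltr_wpDl ?mulr_ge0 ?ler0n.
have [m mT] := filter_ex (one_site_cvg (divr_gt0 h0 K0)).
have chm := channel_ptrace_rest (symT m).1; have [linm _ _] := chm.
(* A loss error of [e / 2] costs twice as much in the risk. *)
apply: le_trans
  (_ : risk k gamma L (one_site (T m)) + (e / 2 + e / 2)%:E <= _)%E; last first.
  by rewrite -splitr leeD2r //; exact: Tr.
apply: risk_perturb => //; first exact: ltW.
move=> Sigma XS; have dS := denX _ XS.
apply: le_trans (lipL _ _ _ XS (channel_density chS dS) (channel_density chm dS)) _.
have := trnorm_channel_diff linS linm dS; rewrite choi_channel_of => trS.
have dl : l1norm (Tstar - choi (one_site (T m))) <= e / 2 / K.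
  apply: le_trans mT; rewrite /l1norm.
  by apply: ler_sum => i _; apply: ler_sum => j _; rewrite !mxE -normcN opprB.
apply: le_trans (_ : `|L0| * (dB%:R * (e / 2 / K)) <= _).
  apply: le_trans (ler_wpM2r (trnorm_ge0 _) (ler_norm L0)) _.
  rewrite ler_wpM2l //; apply: le_trans trS _.
  by rewrite ler_wpM2l ?ler0n.
apply: le_trans (_ : K * (e / 2 / K) <= _); last by rewrite mulrC divfK // gt_eqF.
by rewrite [leLHS]mulrA ler_wpM2r ?lerDl // ltW // divr_gt0.
Qed.

End Limit.

Theorem corollaryS2p4 (R : realType) (dA dB : nat)
    (X : set 'M[R[i]]_dA) (k : risk_kind X)
    (gamma : 'M[R[i]]_dA -> 'M[R[i]]_dB)
    (L : 'M[R[i]]_dB -> 'M[R[i]]_dB -> R)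
    (X_states : forall Sigma, X Sigma -> density Sigma)
    (gamma_states : forall Sigma, X Sigma -> density (gamma Sigma))
    (L_lipschitz : lipschitz_loss X gamma L)
    (L_measurable : risk_measurable k gamma L)
    (c : symmetry_class)
    (T : forall m : nat, 'M[R[i]]_dA -> 'M[R[i]]_(tpow dB m.+1))
    (T_optimal : forall m : nat, optimal_symmetric c k gamma L (T m))
    (Tstar : 'M[R[i]]_(dA * dB))
    (T_cvg : (fun m : nat =>
        trnorm (ampl (@ptrace_rest R dB m) (choi (T m)) - Tstar)) @ \oo
      --> (0 : R)) :
  separable Tstar /\
  exists S : 'M[R[i]]_dA -> 'M[R[i]]_dB,
    [/\ channel S, choi S = Tstar
      & risk k gamma L S = eb_optimal_risk k gamma L].
Proof.
have symT m := (T_optimal m).1.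
have sepT := one_site_limit_separable T_cvg symT.
have chT := one_site_limit_channel T_cvg symT.
split=> //; exists (channel_of Tstar); split=> //; first exact: choi_channel_of.
apply/eqP; rewrite eq_le; apply/andP; split; last first.
  (* The limit channel is itself one of the competitors in the infimum. *)
  apply: ereal_inf_lbound; exists (channel_of Tstar) => //; split=> //.
  by rewrite /entanglement_breaking choi_channel_of.
apply: le_ereal_inf_tmp => _ [S [chS ebS] <-].
apply: (one_site_limit_risk T_cvg X_states L_lipschitz L_measurable symT) => m.
have [T' [symT' T'S]] := entanglement_breaking_protocol c m chS ebS.
by apply: le_trans ((T_optimal m).2 _ symT') _; rewrite /one_site_risk T'S.
Qed.
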